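(* Let $(A_c,A_o,h,\mathscr{L},\lambda,\bar\varepsilon,B_{\rm cap})$ be an energy harvesting control system (EHCS), let $u$ be a memoryless transmission policy, and let $\mathcal{S}=\{0,\dots,B_{\rm cap}\}\times\mathcal{L}\times\{0,1\}\times\{0,1\}$ be the state space of the mode transition process $S(t)=(B(t),L(t),\gamma(t),F(t))$ generated by the EHCS. Fix some constant $D>0$. The EHCS is stable under the transmission policy $u$ if and only if the optimal value of the semidefinite program $$\begin{aligned}\underset{v\in\mathbb{R},\ \{R_s\in\mathbb{S}_+\}_{s\in\mathcal{S}}}{\text{minimize}}\quad & v\\ \text{subject to}\quad & A_s^T\sum_{s'\in\mathcal{S}}\psi_u(s'|s)R_{s'}A_s-R_s\preceq vI\quad\text{for all } s\in\mathcal{S},\\ & v\ge -D,\end{aligned}$$ is equal to $-D$. Here $\mathbb{S}_+$ is the set of symmetric positive semidefinite $n\times n$ matrices, $A_s=A_c$ if the $\gamma$-component of $s$ is $1$ and $A_s=A_o$ if it is $0$, and $\psi_u(s'|s)$ are the transition probabilities of $\{S(t)\}$ under $u$, as given in the context.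
   Context: EHCS. An EHCS is a 7-tuple $(A_c,A_o,h,\mathscr{L},\lambda,\bar\varepsilon,B_{\rm cap})$: $A_c,A_o\in\mathbb{R}^{n\times n}$ are the closed-loop and open-loop plant matrices; $\mathscr{L}$ is the transition matrix of a Markov chain $\{L(t)\}$ on a finite latent set $\mathcal{L}$, with $\mathscr{L}(\ell',\ell)$ the probability of moving from $\ell$ to $\ell'$; $h:\mathcal{L}\to\{0,1,\dots,H_{\max}\}$ gives the harvested energy $H(t)=h(L(t))$; $\lambda$ is the packet reception probability; $\bar\varepsilon$ is the transmission energy threshold; $B_{\rm cap}$ is the finite battery capacity. The latent process is independent of the other stochastic processes of the model. Write $[[y]]=\min(\max(y,0),B_{\rm cap})$. Memoryless transmission policy. $u(\varepsilon|B(t),L(t),F(t))=\mathbb{P}(\mathcal{E}(t)=\varepsilon\mid B(t),L(t),F(t))$ is the conditional distribution of the transmission energy $\mathcal{E}(t)$ given the current battery level, latent state and transmission history value, subject to the energy availability constraint $\mathcal{E}(t)\le B(t)+H(t)$ (so $\mathcal{E}(t)\in\{0,\dots,H_{\max}+B_{\rm cap}\}$). Dynamics. $\mathbb{P}(\gamma(t)=1\mid\mathcal{E}(t)=\varepsilon)=\lambda$ if $\varepsilon\ge\bar\varepsilon$ and $0$ otherwise, with $\gamma(t)\in\{0,1\}$. Battery: $B(t+1)=[[B(t)+H(t)-\mathcal{E}(t)]]$. History: $F(t+1)=1$ if $\mathcal{E}(t)\ge\bar\varepsilon$ and $F(t+1)=0$ otherwise. Plant under $u$: $x_u(t+1)=A_cx_u(t)+\omega(t)$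 if $\gamma(t)=1$ and $x_u(t+1)=A_ox_u(t)+\omega(t)$ if $\gamma(t)=0$, where $\{\omega(t)\}$ is i.i.d. with mean zero and finite, positive definite second moment matrix $W$. Stability. The EHCS is stable under $u$ if $\{x_u(t)\}$ is mean-square exponentially ultimately bounded: there exist finite constants $\alpha\ge1$, $\xi\in(0,1)$, $M\ge0$ such that $\mathbb{E}\|x_u(t)\|_2^2\le\alpha\xi^t\,\mathbb{E}\|x_u(0)\|_2^2+M\,\mathrm{Tr}(W)$ for all $t\in\mathbb{Z}_{\ge0}$ and any square integrable $x_u(0)$. Transition probabilities. $\psi_u(s'|s)=\mathbb{P}_u(S(t+1)=s'\mid S(t)=s)$ is specified as follows. Let $b,\ell,\gamma,\varepsilon,f$ be the battery level, latent state, loop closure state, energy usage and transmission history value of the system at state $s$, and $b',\ell',\gamma',\varepsilon',f'$ likewise for $s'$. Let $u_s^{\varepsilon}$ be the probability that $u$ uses energy $\varepsilon$ at state $s$, and let $u_{s'}^{\{\varepsilon'\ge\bar\varepsilon\}}$ and $u_{s'}^{\{\varepsilon'<\bar\varepsilon\}}$ be the probabilities that the energy used at state $s'$ is at least $\bar\varepsilon$, respectively less than $\bar\varepsilon$. For all transitions from $s$ to $s'$ that occur with positive probability, $$\psi_u(s'|s)=\begin{cases}\lambda\,u_{s'}^{\{\varepsilon'\ge\bar\varepsilon\}}\,u_s^{\varepsilon}\,\mathscr{L}(\ell',\ell), & \gamma'=1,\\ \big((1-\lambda)\,u_{s'}^{\{\varepsilon'\ge\bar\varepsilon\}}+u_{s'}^{\{\varepsilon'<\bar\varepsilon\}}\big)\,u_s^{\varepsilon}\,\mathscr{L}(\ell',\ell),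 & \gamma'=0,\end{cases}$$ and $\psi_u(s'|s)=0$ for all transitions which occur with zero probability because they do not adhere to the battery dynamics ($b'=[[b+h(\ell)-\varepsilon]]$) or the history dynamics ($f'=1$ if $\varepsilon\ge\bar\varepsilon$, $f'=0$ otherwise).
   Formalization: In ψ_u, u_s^ε is the policy conditioned on the loop closure γ recorded in s (summed over energies giving the same transition), since with plain u(ε|b,ℓ,f) the claim fails; stability is taken uniformly over initial modes and all disturbance laws with second moment W. *)

(* Defs.v *)
From HB Require Import structures.
From mathcomp Require Import all_boot all_order all_algebra.
From mathcomp Require Import all_classical all_reals all_analysis.
Set Implicit Arguments.
Unset Strict Implicit.
Unset Printing Implicit Defensive.
Import Order.TTheory GRing.Theory Num.Theory.
Local Open Scope classical_set_scope.
Local Open Scope ring_scope.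

Definition psdmx (R : realType) (n : nat) (A : 'M[R]_n) : Prop :=
  A^T = A /\ forall x : 'cV[R]_n, 0 <= (x^T *m A *m x) 0 0.

Definition pdmx (R : realType) (n : nat) (A : 'M[R]_n) : Prop :=
  A^T = A /\ forall x : 'cV[R]_n, x != 0 -> 0 < (x^T *m A *m x) 0 0.

Definition loewner_le (R : realType) (n : nat) (A B : 'M[R]_n) : Prop :=
  psdmx (B - A).

(* Squared Euclidean norm; the library norm [`|x|] on matrices is the
   maximum norm. *)
Definition sqnorm2 (R : realType) (n : nat) (x : 'cV[R]_n) : R :=
  \sum_i x i 0 ^+ 2.

(* [trans l' l] is the probability of moving from [l] to [l'], so it is the
   columns that sum to one.  The threshold may be any real number; energies
   themselves are integers. *)
Record ehcs (R : realType) (n : nat) (Lat : finType) (Hmax : nat) := EHCS {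
  Ac : 'M[R]_n;
  Ao : 'M[R]_n;
  harvest : Lat -> 'I_Hmax.+1;
  trans : Lat -> Lat -> R;
  lam : R;
  eps_bar : R;
  Bcap : nat;
  trans_ge0 : forall l' l, 0 <= trans l' l;
  trans_sum1 : forall l, \sum_l' trans l' l = 1;
  lam_prob : 0 <= lam <= 1 }.

Section Model.
Context {R : realType} {n : nat} {Lat : finType} {Hmax : nat}.
Variable Sys : ehcs R n Lat Hmax.

Definition level := 'I_(Bcap Sys).+1.
Definition energy := 'I_(Hmax + Bcap Sys).+1.

Record policy := Policy {
  prob :> level -> Lat -> bool -> energy -> R;
  prob_ge0 : forall b l f e, 0 <= prob b l f e;
  prob_sum1 : forall b l f, \sum_e prob b l f e = 1;
  prob_avail : forall (b : level) l f (e : energy),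
    (b + harvest Sys l < e)%N -> prob b l f e = 0 }.

(* [[ b + h(l) - e ]]: the truncated subtraction is the clipping at 0. *)
Definition next_level (b : level) (l : Lat) (e : energy) : level :=
  inord (minn (b + harvest Sys l - e) (Bcap Sys)).

Definition transmits (e : energy) : bool := eps_bar Sys <= e%:R.

(* P(gamma(t) = g | E(t) = e) *)
Definition loop_prob (e : energy) (g : bool) : R :=
  let p := if transmits e then lam Sys else 0 in if g then p else 1 - p.

Definition plant_mx (g : bool) : 'M[R]_n := if g then Ac Sys else Ao Sys.

(* Mode (B, L, gamma, F). *)
Definition mode := (level * Lat * bool * bool)%type.

Definition mode_mx (s : mode) : 'M[R]_n :=
  let: (_, _, g, _) := s in plant_mx g.

(* Probability P(E(t) = e | S(t) = s) of using energy [e] at mode [s].  Since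
   [s] records the loop closure gamma(t), which is caused by E(t), this is the
   policy conditioned on gamma(t) = g by Bayes' rule; for instance a closed loop
   rules out every energy below the threshold.  It is 0 (as x / 0 = 0) at the
   modes at which gamma(t) = g is impossible, and these modes are never
   visited. *)
Definition mode_energy_prob (u : policy) (s : mode) (e : energy) : R :=
  let: (b, l, g, f) := s in
  u b l f e * loop_prob e g / \sum_e' u b l f e' * loop_prob e' g.

(* Probability that the policy transmits given B, L and F only: in [psi] it is
   evaluated at the successor, whose loop closure is then drawn. *)
Definition transmit_prob (u : policy) (s : mode) : R :=
  let: (b, l, _, f) := s in \sum_(e | transmits e) u b l f e.

Definition silent_prob (u : policy) (s : mode) : R :=
  let: (b, l, _, f) := s in \sum_(e | ~~ transmits e) u b l f e.

(* psi(s' | s).  Because of the clipping at the battery capacity, several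
   energies may lead from [s] to [s']; their contributions add up. *)
Definition psi (u : policy) (s' s : mode) : R :=
  let: (b, l, _, _) := s in
  let: (b', l', g', f') := s' in
  (if g' then lam Sys * transmit_prob u s'
   else (1 - lam Sys) * transmit_prob u s' + silent_prob u s')
  * (\sum_(e | (b' == next_level b l e) && (f' == transmits e))
        mode_energy_prob u s e)
  * trans Sys l' l.

Record processes (T : Type) := Processes {
  bat : nat -> T -> level;
  lat : nat -> T -> Lat;
  ener : nat -> T -> energy;
  loop : nat -> T -> bool;
  hist : nat -> T -> bool;
  noise : nat -> T -> 'cV[R]_n;
  plant : nat -> T -> 'cV[R]_n }.

Section Realization.
Context {T : Type} (X : processes T).

(* Elementary events of the past at time [t]: the initial plant state, battery
   level and history value, the latent states up to time [t], and the energies,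
   loop closures and disturbances before time [t].  By the dynamics, they
   determine the plant, battery and history processes up to time [t]. *)
Inductive past_event (t : nat) : set T -> Prop :=
| past_plant i (C : set R) : measurable C ->
    past_event t [set w | C (plant X 0 w i 0)]
| past_bat b : past_event t [set w | bat X 0 w = b]
| past_hist f : past_event t [set w | hist X 0 w = f]
| past_lat k l : (k <= t)%N -> past_event t [set w | lat X k w = l]
| past_ener k e : (k < t)%N -> past_event t [set w | ener X k w = e]
| past_loop k g : (k < t)%N -> past_event t [set w | loop X k w = g]
| past_noise k i (C : set R) : (k < t)%N -> measurable C ->
    past_event t [set w | C (noise X k w i 0)].

Definition past (t : nat) : set (set T) := <<s past_event t >>.

Definition in_box (y : 'cV[R]_n) (C : 'I_n -> set R) : Prop :=
  forall i, C i (y i 0).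

End Realization.

(* [X] is a run of the system under [u], driven by disturbances with second
   moment matrix [W], from an arbitrary initial condition.

   In [step_law], given the past up to time [t], the energy is drawn from the
   policy at the current battery level, latent state and history value; the
   loop closure depends on the energy only; the latent chain moves
   autonomously; and the disturbance is independent of all of these and of the
   past, with the same law as at time 0.  Boxes determine the joint law of the
   coordinates of the disturbance. *)
Record realization (u : policy) (W : 'M[R]_n) (d : measure_display)
    (T : measurableType d) (P : probability T R) (X : processes T) : Prop := {
  past_measurable : forall t A, past_event X t A -> measurable A;
  bat_dyn : forall t w,
    bat X t.+1 w = next_level (bat X t w) (lat X t w) (ener X t w);
  hist_dyn : forall t w, hist X t.+1 w = transmits (ener X t w);
  plant_dyn : forall t w,
    plant X t.+1 w = plant_mx (loop X t w) *m plant X t w + noise X t w;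
  step_law : forall t A, past X t A ->
    forall b l f e g l' (C : 'I_n -> set R), (forall i, measurable (C i)) ->
    let now := A `&` [set w | [/\ bat X t w = b, lat X t w = l
                                & hist X t w = f]] in
    (P (now `&` [set w | [/\ ener X t w = e, loop X t w = g,
                             in_box (noise X t w) C & lat X t.+1 w = l']])
     = (u b l f e * loop_prob e g * trans Sys l' l)%:E
       * P [set w | in_box (noise X 0 w) C] * P now)%E;
  latent_indep0 : forall b l f (C : 'I_n -> set R),
    (forall i, measurable (C i)) ->
    let init := [set w | [/\ in_box (plant X 0 w) C, bat X 0 w = b
                           & hist X 0 w = f]] in
    (P (init `&` [set w | lat X 0 w = l])
     = P init * P [set w | lat X 0 w = l])%E;
  noise_mean : forall i, ('E_P[fun w => noise X 0 w i 0%R] = 0)%E;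
  noise_moment : forall i j,
    ('E_P[fun w => (noise X 0 w i 0 * noise X 0 w j 0)%R] = (W i j)%:E)%E }.

(* Mean-square exponential ultimate boundedness, with constants that are
   uniform in the initial condition. *)
Definition stable (u : policy) (W : 'M[R]_n) : Prop :=
  exists alpha xi M : R, [/\ 1 <= alpha, 0 < xi < 1, 0 <= M &
    forall (d : measure_display) (T : measurableType d) (P : probability T R)
           (X : processes T),
      realization u W P X ->
      ('E_P[fun w => sqnorm2 (plant X 0 w)] < +oo)%E ->
      forall t : nat,
        ('E_P[fun w => sqnorm2 (plant X t w)]
         <= (alpha * xi ^+ t)%:E * 'E_P[fun w => sqnorm2 (plant X 0 w)]
            + (M * \tr W)%:E)%E].

Definition sdp_feasible (u : policy) (D v : R) (Q : mode -> 'M[R]_n) : Prop :=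
  [/\ forall s, psdmx (Q s),
      forall s, loewner_le
        ((mode_mx s)^T *m (\sum_(s' : mode) psi u s' s *: Q s') *m mode_mx s
         - Q s)
        v%:M
    & - D <= v].

Definition sdp_value (u : policy) (D : R) : \bar R :=
  ereal_inf [set v%:E | v in [set v | exists Q, sdp_feasible u D v Q]].

End Model.

(* Main.v *)
From HB Require Import structures.
Require Import Defs.
From mathcomp Require Import all_boot all_order all_algebra.
From mathcomp Require Import all_classical all_reals all_analysis.
From mathcomp Require Import measurable_realfun ring lra.
Set Implicit Arguments.
Unset Strict Implicit.
Unset Printing Implicit Defensive.
Import Order.TTheory GRing.Theory Num.Theory.
Local Open Scope classical_set_scope.
Local Open Scope ring_scope.

(* By scaling, the optimal value is -D iff some feasible v is negative.  The
   loop closure is drawn after the energy, so averaging the matrices over it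
   turns this into a Lyapunov condition on the triples (B, L, F): there are
   positive semidefinite V_c with T V <= V - d I for some d > 0, where T is the
   dual of the second moment recursion of the disturbance-free plant.

   If such a V exists, the expectation of x^T V_(B, L, F) x contracts up to a
   constant; Young's inequality disposes of the cross terms.

   Conversely, runs started from x and -x with the same disturbances differ by
   twice the disturbance-free response, whence x^T (T^t I) x is at most
   alpha xi^t |x|^2 + M tr W; rescaling x removes the constant, and the sum of
   T^t I over t < N with alpha xi^N <= 1/2 is a Lyapunov family.  The runs live
   on [0, 1[ with Lebesgue measure, cut into nested intervals indexed by the
   finite paths, with disturbances +- sqrt(n) B e_k where W = B B^T. *)

(** * Quadratic forms and the positive semidefinite order *)

Section QuadraticForm.
Context {R : realType} {n : nat}.
Implicit Types (V A B : 'M[R]_n) (x y : 'cV[R]_n).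

Definition bf V x y : R := (x^T *m V *m y) 0 0.
Definition qf V x : R := bf V x x.

Lemma qfE V x : qf V x = \sum_i \sum_j x i 0 * x j 0 * V i j.
Proof.
rewrite /qf /bf !mxE exchange_big /=; apply: eq_bigr => j _.
rewrite !mxE mulr_suml; apply: eq_bigr => i _; rewrite !mxE; ring.
Qed.

Lemma bfDl V x y z : bf V (x + y) z = bf V x z + bf V y z.
Proof. by rewrite /bf linearD !mulmxDl mxE. Qed.
Lemma bfDr V x y z : bf V z (x + y) = bf V z x + bf V z y.
Proof. by rewrite /bf !mulmxDr mxE. Qed.
Lemma bfZl V a x y : bf V (a *: x) y = a * bf V x y.
Proof. by rewrite /bf linearZ -!scalemxAl mxE. Qed.
Lemma bfZr V a x y : bf V y (a *: x) = a * bf V y x.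
Proof. by rewrite /bf -!scalemxAr mxE. Qed.
Lemma bf_sym V x y : V^T = V -> bf V x y = bf V y x.
Proof.
by move=> Vs; rewrite /bf -[in RHS](trmxK (_ *m x)) [RHS]mxE !trmx_mul trmxK Vs mulmxA.
Qed.

Lemma qfD A B x : qf (A + B) x = qf A x + qf B x.
Proof. by rewrite /qf /bf mulmxDr mulmxDl mxE. Qed.
Lemma qfN A x : qf (- A) x = - qf A x.
Proof. by rewrite /qf /bf mulmxN mulNmx mxE. Qed.
Lemma qfB A B x : qf (A - B) x = qf A x - qf B x.
Proof. by rewrite qfD qfN. Qed.
Lemma qfZ a A x : qf (a *: A) x = a * qf A x.
Proof. by rewrite /qf /bf -scalemxAr -scalemxAl mxE. Qed.
Lemma qf0 x : qf 0 x = 0.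
Proof. by rewrite /qf /bf mulmx0 mul0mx mxE. Qed.
Lemma qf_sum (I : finType) (P : pred I) (F : I -> 'M[R]_n) x :
  qf (\sum_(i | P i) F i) x = \sum_(i | P i) qf (F i) x.
Proof. by apply: (big_morph (qf^~ x)) => [A B|]; rewrite ?qfD ?qf0. Qed.
Lemma qf_congr A V x : qf (A^T *m V *m A) x = qf V (A *m x).
Proof. by rewrite /qf /bf trmx_mul !mulmxA. Qed.
Lemma qfZv a A x : qf A (a *: x) = a ^+ 2 * qf A x.
Proof. by rewrite /qf bfZl bfZr mulrA. Qed.
Lemma qfNv A x : qf A (- x) = qf A x.
Proof. by rewrite -scaleN1r qfZv sqrrN expr1n mul1r. Qed.

Lemma sqnorm2_ge0 x : 0 <= sqnorm2 x.
Proof. by apply: sumr_ge0 => i _; exact: sqr_ge0. Qed.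

Lemma qf_scalar a x : qf a%:M x = a * sqnorm2 x.
Proof.
by rewrite -scalemx1 qfZ /qf /bf mulmx1 /sqnorm2 mxE; congr (_ * _);
  apply: eq_bigr => i _; rewrite mxE expr2.
Qed.

Lemma qf1 x : qf 1%:M x = sqnorm2 x.
Proof. by rewrite qf_scalar mul1r. Qed.

Lemma psd_qf_ge0 V x : psdmx V -> 0 <= qf V x.
Proof. by case=> _; apply. Qed.

Lemma psdP V : V^T = V -> (forall x, 0 <= qf V x) -> psdmx V.
Proof. by []. Qed.

Lemma psd0 : psdmx (0 : 'M[R]_n).
Proof. by split=> [|x]; [exact: trmx0|rewrite -/(bf _ _ _) -/(qf _ _) qf0]. Qed.

Lemma psdD A B : psdmx A -> psdmx B -> psdmx (A + B).
Proof.
move=> [As pA] [Bs pB]; apply: psdP; first by rewrite linearD /= As Bs.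
by move=> x; rewrite qfD addr_ge0 // ?pA ?pB.
Qed.

Lemma psdZ a A : 0 <= a -> psdmx A -> psdmx (a *: A).
Proof.
move=> a0 [As pA]; apply: psdP; first by rewrite linearZ /= As.
by move=> x; rewrite qfZ mulr_ge0 // pA.
Qed.

Lemma psd_sum (I : finType) (P : pred I) (F : I -> 'M[R]_n) :
  (forall i, P i -> psdmx (F i)) -> psdmx (\sum_(i | P i) F i).
Proof. by move=> pF; apply: big_ind => //; [exact: psd0|exact: psdD]. Qed.

Lemma psd_congr A V : psdmx V -> psdmx (A^T *m V *m A).
Proof.
move=> [Vs pV]; apply: psdP; first by rewrite !trmx_mul trmxK Vs mulmxA.
by move=> x; rewrite qf_congr; exact: pV.
Qed.

Lemma psd_scalar a : 0 <= a -> psdmx (a%:M : 'M[R]_n).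
Proof.
move=> a0; apply: psdP => [|x]; first exact: tr_scalar_mx.
by rewrite qf_scalar mulr_ge0 ?sqnorm2_ge0.
Qed.

Lemma loewner_leP A B : A^T = A -> B^T = B ->
  loewner_le A B <-> forall x, qf A x <= qf B x.
Proof.
move=> As Bs; split=> [[_ p] x|p].
  by rewrite -subr_ge0 -qfB; exact: p.
apply: psdP; first by rewrite linearB /= As Bs.
by move=> x; rewrite qfB subr_ge0.
Qed.

(** Nonnegativity of the form at d x - y, divided by d, bounds twice the cross term by d times the
    form at x plus 1/d times the form at y. *)
Lemma qf_young V x y (d : R) : psdmx V -> 0 < d ->
  qf V (x + y) <= (1 + d) * qf V x + (1 + d^-1) * qf V y.
Proof.
move=> pV d0; have Vs : V^T = V by case: pV.
have := psd_qf_ge0 (d *: x - y) pV.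
rewrite /qf !(bfDl, bfDr) -scaleN1r !(bfZl, bfZr) (bf_sym y x Vs).
set a := bf V x x; set b := bf V x y; set c := bf V y y => h.
have : 0 <= d^-1 * (d * (d * a) + -1 * (d * b) + (d * (-1 * b) + -1 * (-1 * c))).
  by apply: mulr_ge0; [rewrite invr_ge0 ltW|lra].
have -> : d^-1 * (d * (d * a) + -1 * (d * b) + (d * (-1 * b) + -1 * (-1 * c))) =
  d * a - 2 * b + d^-1 * c by field; rewrite gt_eqF.
lra.
Qed.

Lemma qf_le_sqnorm2 V x : qf V x <= (\sum_i \sum_j `|V i j|) * sqnorm2 x.
Proof.
rewrite qfE mulr_suml; apply: ler_sum => i _; rewrite mulr_suml.
apply: ler_sum => j _; apply: (le_trans (ler_norm _)); rewrite !normrM mulrC.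
apply: ler_wpM2l => //.
(* Each square x_k^2 is at most |x|^2, so |x_i| |x_j| <= (x_i^2 + x_j^2) / 2 <= |x|^2. *)
have sq k : x k 0 ^+ 2 <= sqnorm2 x.
  by rewrite /sqnorm2 (bigD1 k) //= lerDl; apply: sumr_ge0 => ? _; exact: sqr_ge0.
have := sq i; have := sq j; rewrite -(real_normK (num_real (x j 0))).
rewrite -(real_normK (num_real (x i 0))) => hj hi.
have := sqr_ge0 (`|x i 0| - `|x j 0|); nra.
Qed.

End QuadraticForm.

(** * From the semidefinite program to the Lyapunov condition *)

Section Lyapunov.
Context {R : realType} {n : nat} {Lat : finType} {Hmax : nat}.
Variables (Sys : ehcs R n Lat Hmax) (u : policy Sys).

Definition config := (level Sys * Lat * bool)%type.
Definition draw := (energy Sys * bool * Lat)%type.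

Definition next_config (c : config) (o : draw) : config :=
  (next_level c.1.1 c.1.2 o.1.1, o.2, transmits o.1.1).

Definition step_prob (c : config) (o : draw) : R :=
  u c.1.1 c.1.2 c.2 o.1.1 * loop_prob o.1.1 o.1.2 * trans Sys o.2 c.1.2.

(* Dual of the second moment recursion: the expectation of [qf (V _)] at the
   next homogeneous plant state is [qf (adjoint V _)] at the current one. *)
Definition adjoint (V : config -> 'M[R]_n) (c : config) : 'M[R]_n :=
  \sum_(o : draw) step_prob c o *:
    ((plant_mx Sys o.1.2)^T *m V (next_config c o) *m plant_mx Sys o.1.2).

Definition lyapunov : Prop :=
  exists (d : R) (V : config -> 'M[R]_n), [/\ 0 < d, forall c, psdmx (V c) &
    forall c x, qf (adjoint V c) x <= qf (V c) x - d * sqnorm2 x].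

Lemma loop_prob_ge0 (e : energy Sys) g : 0 <= loop_prob e g.
Proof.
have /andP[l0 l1] := lam_prob Sys; rewrite /loop_prob.
by case: g; case: ifP => _; rewrite ?subr0 ?subr_ge0.
Qed.

Lemma loop_prob_sum1 (e : energy Sys) : \sum_g loop_prob e g = 1.
Proof. by rewrite big_bool /loop_prob /=; lra. Qed.

Lemma step_prob_ge0 c o : 0 <= step_prob c o.
Proof. by rewrite !mulr_ge0 ?prob_ge0 ?loop_prob_ge0 ?trans_ge0. Qed.

Lemma sum_draw (F : draw -> R) :
  \sum_o F o = \sum_e \sum_g \sum_l F (e, g, l).
Proof.
rewrite pair_bigA /= pair_bigA /=; apply: eq_bigr => -[[e g] l] _ //.
Qed.

Lemma step_prob_sum1 c : \sum_o step_prob c o = 1.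
Proof.
rewrite sum_draw -[RHS](prob_sum1 u c.1.1 c.1.2 c.2); apply: eq_bigr => e _.
rewrite -[RHS]mulr1 -(loop_prob_sum1 e) mulr_sumr; apply: eq_bigr => g _.
by rewrite -[RHS]mulr1 -(trans_sum1 Sys c.1.2) mulr_sumr.
Qed.

Lemma qf_adjoint V c x : qf (adjoint V c) x =
  \sum_o step_prob c o * qf (V (next_config c o)) (plant_mx Sys o.1.2 *m x).
Proof. by rewrite qf_sum; apply: eq_bigr => o _; rewrite qfZ qf_congr. Qed.

Lemma psd_adjoint V : (forall c, psdmx (V c)) -> forall c, psdmx (adjoint V c).
Proof.
move=> pV c; apply: psd_sum => o _; apply: psdZ; first exact: step_prob_ge0.
exact: psd_congr.
Qed.

(** The probability of gamma = g at the configuration [c]; it is the denominator of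
    [mode_energy_prob]. *)
Definition loop_weight (c : config) (g : bool) : R :=
  \sum_e u c.1.1 c.1.2 c.2 e * loop_prob e g.

Lemma loop_weight_ge0 c g : 0 <= loop_weight c g.
Proof. by apply: sumr_ge0 => e _; rewrite mulr_ge0 ?prob_ge0 ?loop_prob_ge0. Qed.

Lemma loop_weight_sum1 c : \sum_g loop_weight c g = 1.
Proof.
rewrite exchange_big /= -[RHS](prob_sum1 u c.1.1 c.1.2 c.2).
by apply: eq_bigr => e _; rewrite -mulr_sumr loop_prob_sum1 mulr1.
Qed.

(** Splitting the energies at the threshold identifies the case distinction on gamma' in [psi] with
    the law of the loop closure at the successor. *)
Lemma loop_weightE b l g f :
  loop_weight (b, l, f) g = if g then lam Sys * transmit_prob u (b, l, g, f)
  else (1 - lam Sys) * transmit_prob u (b, l, g, f) + silent_prob u (b, l, g, f).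
Proof.
rewrite /loop_weight /transmit_prob /silent_prob /=.
rewrite (bigID (fun e => transmits e)) /=.
case: g.
  rewrite [X in _ + X]big1 ?addr0; last first.
    by move=> e /negbTE he; rewrite /loop_prob he mulr0.
  by rewrite mulr_sumr; apply: eq_bigr => e he; rewrite /loop_prob he mulrC.
congr (_ + _).
  by rewrite mulr_sumr; apply: eq_bigr => e he; rewrite /loop_prob he mulrC.
by apply: eq_bigr => e /negbTE he; rewrite /loop_prob he subr0 mulr1.
Qed.

Definition config_of (s : mode Sys) : config := (s.1.1.1, s.1.1.2, s.2).
Definition mode_of (c : config) (g : bool) : mode Sys := (c.1.1, c.1.2, g, c.2).

(** A successor mode is reached by drawing an energy, then a latent state, then a loop closure.
    Exchanging the sum over successors with the sum over energies inside [psi] makes this order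
    visible. *)
Lemma psi_sum (s : mode Sys) (F : mode Sys -> R) :
  \sum_s' psi u s' s * F s' = \sum_e \sum_l mode_energy_prob u s e *
    trans Sys l s.1.1.2 *
    \sum_g loop_weight (next_config (config_of s) (e, g, l)) g *
      F (mode_of (next_config (config_of s) (e, g, l)) g).
Proof.
case: s => [[[b l] g] f].
pose G e b' l' g' f' := mode_energy_prob u (b, l, g, f) e * trans Sys l' l *
   (loop_weight (b', l', f') g' * F (b', l', g', f')).
transitivity (\sum_b' \sum_l' \sum_g' \sum_f'
    \sum_(e | (b' == next_level b l e) && (f' == transmits e)) G e b' l' g' f').
  rewrite pair_bigA /= pair_bigA /= pair_bigA /=.
  apply: eq_bigr => -[[[b' l'] g'] f'] _ /=.
  rewrite /psi -loop_weightE mulr_sumr !mulr_suml; apply: eq_bigr => e _.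
  by rewrite /G; set m := mode_energy_prob _ _ _; rewrite -[X in _ * X * _ * _]/m; ring.
transitivity (\sum_e \sum_l' \sum_g' \sum_b' \sum_(f' | (b' == next_level b l e)
    && (f' == transmits e)) G e b' l' g' f').
  transitivity (\sum_b' \sum_l' \sum_g' \sum_e
    \sum_(f' | (b' == next_level b l e) && (f' == transmits e)) G e b' l' g' f').
    apply: eq_bigr => b' _; apply: eq_bigr => l' _; apply: eq_bigr => g' _.
    by rewrite (exchange_big_dep predT).
  rewrite exchange_big /= [RHS]exchange_big /=; apply: eq_bigr => l' _.
  rewrite exchange_big /= [RHS]exchange_big /=; apply: eq_bigr => g' _.
  by rewrite exchange_big.
(* Once the energy is fixed, only one b' and one f' obey the dynamics, so the two inner sums
   collapse to one term. *)
apply: eq_bigr => e _; apply: eq_bigr => l' _; rewrite mulr_sumr.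
apply: eq_bigr => g' _; rewrite (bigD1 (next_level b l e)) //= eqxx /=.
rewrite [X in _ + X]big1 ?addr0 ?big_pred1_eq //.
by move=> b' /negbTE ->; rewrite big_pred0.
Qed.

(** The candidate Lyapunov family built from a feasible point of the program. *)
Definition mode_value (Q : mode Sys -> 'M[R]_n) (c : config) : 'M[R]_n :=
  \sum_g loop_weight c g *: Q (mode_of c g).

Lemma qf_mode_value Q c x :
  qf (mode_value Q c) x = \sum_g loop_weight c g * qf (Q (mode_of c g)) x.
Proof. by rewrite qf_sum; apply: eq_bigr => g _; rewrite qfZ. Qed.

Lemma psd_mode_value Q : (forall s, psdmx (Q s)) -> forall c, psdmx (mode_value Q c).
Proof.
move=> pQ c; apply: psd_sum => g _; apply: psdZ => //; exact: loop_weight_ge0.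
Qed.

Lemma qf_psi_sum (Q : mode Sys -> 'M[R]_n) s x :
  qf (\sum_s' psi u s' s *: Q s') x =
  \sum_e \sum_l mode_energy_prob u s e * trans Sys l s.1.1.2 *
    qf (mode_value Q (next_level s.1.1.1 s.1.1.2 e, l, transmits e)) x.
Proof.
rewrite qf_sum; under eq_bigr do rewrite qfZ.
rewrite psi_sum; apply: eq_bigr => e _; apply: eq_bigr => l _.
by rewrite qf_mode_value.
Qed.

(** Bayes' rule. When the denominator is 0 the left side vanishes, and so does the right side, being
    one of the nonnegative terms that sum to 0. *)
Lemma loop_weight_mode_energy c g e :
  loop_weight c g * mode_energy_prob u (mode_of c g) e =
  u c.1.1 c.1.2 c.2 e * loop_prob e g.
Proof.
case: c => [[b l] f] /=; rewrite /mode_energy_prob -/(loop_weight (b, l, f) g).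
have [w0|w0] := eqVneq (loop_weight (b, l, f) g) 0; last first.
  by rewrite mulrC divfK.
rewrite w0 mul0r; apply/esym/eqP; move/eqP: w0.
rewrite /loop_weight psumr_eq0 => [/allP/(_ e)|e' _].
  by rewrite mem_index_enum => /(_ isT).
by rewrite mulr_ge0 ?prob_ge0 ?loop_prob_ge0.
Qed.

Lemma mode_energy_prob_ge0 s e : 0 <= mode_energy_prob u s e.
Proof.
case: s => [[[b l] g] f]; rewrite divr_ge0 ?mulr_ge0 ?prob_ge0 ?loop_prob_ge0 //.
exact: (loop_weight_ge0 (b, l, f) g).
Qed.

Lemma mode_mxE (s : mode Sys) : mode_mx s = plant_mx Sys s.1.2.
Proof. by case: s => [[[]]]. Qed.

(** Averaging over gamma cancels the conditioning on gamma in [mode_energy_prob]; what remains is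
    the unconditional law [step_prob] of the draw. *)
Lemma loop_weight_psi (Q : mode Sys -> 'M[R]_n) c x :
  \sum_g loop_weight c g * qf (\sum_s' psi u s' (mode_of c g) *: Q s')
     (plant_mx Sys g *m x) = qf (adjoint (mode_value Q) c) x.
Proof.
rewrite qf_adjoint sum_draw [RHS]exchange_big; apply: eq_bigr => g _.
rewrite qf_psi_sum mulr_sumr; apply: eq_bigr => e _.
rewrite mulr_sumr; apply: eq_bigr => l _.
have := loop_weight_mode_energy c g e; set m := mode_energy_prob _ _ _ => wm.
  by rewrite -[X in X * trans _ _ _]/m /step_prob -wm !mulrA.
Qed.

Lemma psd_sym (A : 'M[R]_n) : psdmx A -> A^T = A. Proof. by case. Qed.

Lemma sum_trmx (I : finType) (F : I -> 'M[R]_n) :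
  (forall i, (F i)^T = F i) -> (\sum_i F i)^T = \sum_i F i.
Proof. by move=> Fs; rewrite linear_sum /=; apply: eq_bigr => i _; rewrite Fs. Qed.

(** The matrices involved are symmetric, so the Loewner constraint can be read on quadratic forms,
    with the congruence by A_s turned into evaluation at A_s x. *)
Lemma sdp_feasibleP D v (Q : mode Sys -> 'M[R]_n) :
  sdp_feasible u D v Q <-> [/\ forall s, psdmx (Q s),
    forall s x, qf (\sum_s' psi u s' s *: Q s') (plant_mx Sys s.1.2 *m x)
       <= qf (Q s) x + v * sqnorm2 x & - D <= v].
Proof.
have key s : (forall s, psdmx (Q s)) -> loewner_le
  ((mode_mx s)^T *m (\sum_s' psi u s' s *: Q s') *m mode_mx s - Q s) v%:M <->
  forall x, qf (\sum_s' psi u s' s *: Q s') (plant_mx Sys s.1.2 *m x)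
       <= qf (Q s) x + v * sqnorm2 x.
  move=> pQ; rewrite loewner_leP ?tr_scalar_mx //; last first.
    rewrite linearB /= !trmx_mul trmxK sum_trmx ?(psd_sym (pQ s)) ?mulmxA // => s'.
    by rewrite linearZ /= psd_sym.
  by split=> h x; move: (h x);
     rewrite qfB qf_congr qf_scalar mode_mxE lerBlDl.
by split=> -[pQ le vD]; split=> // s; exact/key/le.
Qed.

(** Averaging the constraints at the two modes over [c] with [loop_weight] preserves the margin -v,
    because the weights sum to one. *)
Lemma lyapunov_of_feasible D v Q : sdp_feasible u D v Q -> v < 0 -> lyapunov.
Proof.
move=> /sdp_feasibleP[pQ le _] v0; exists (- v), (mode_value Q).
split; [by rewrite oppr_gt0|exact: psd_mode_value|move=> c x].
rewrite -loop_weight_psi mulNr opprK.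
apply: (@le_trans _ _ (\sum_g loop_weight c g *
    (qf (Q (mode_of c g)) x + v * sqnorm2 x))).
  by apply: ler_sum => g _; rewrite ler_wpM2l ?loop_weight_ge0.
under eq_bigr do rewrite mulrDr.
by rewrite big_split /= -qf_mode_value -mulr_suml loop_weight_sum1 mul1r.
Qed.

(* Given [V], the matrix at mode [s] is the expectation of [V] after one step
   from [s], plus [d I] to make the inequality strict. *)
Lemma feasible_of_lyapunov D : 0 < D -> lyapunov -> exists Q, sdp_feasible u D (- D) Q.
Proof.
move=> D0 [d [V [d0 pV leV]]].
pose K s := \sum_e \sum_l (mode_energy_prob u s e * trans Sys l s.1.1.2) *:
    V (next_level s.1.1.1 s.1.1.2 e, l, transmits e).
have qfK s x : qf (K s) x = \sum_e \sum_l (mode_energy_prob u s e *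
   trans Sys l s.1.1.2) * qf (V (next_level s.1.1.1 s.1.1.2 e, l, transmits e)) x.
  rewrite qf_sum; apply: eq_bigr => e _; rewrite qf_sum.
  by apply: eq_bigr => l _; rewrite qfZ.
pose Q s := (plant_mx Sys s.1.2)^T *m K s *m plant_mx Sys s.1.2 + d%:M.
have pQ s : psdmx (Q s).
  apply: psdD; last exact/psd_scalar/ltW.
  apply: psd_congr; apply: psd_sum => e _; apply: psd_sum => l _.
  by apply: psdZ => //; rewrite mulr_ge0 ?mode_energy_prob_ge0 ?trans_ge0.
have qQ s x : qf (Q s) x = qf (K s) (plant_mx Sys s.1.2 *m x) + d * sqnorm2 x.
  by rewrite qfD qf_congr qf_scalar.
(* By Bayes' rule the average of [Q] over the loop closure is the adjoint of [V] plus d I, which the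
   Lyapunov inequality bounds by [V]. *)
have VQ c x : qf (mode_value Q c) x <= qf (V c) x.
  rewrite qf_mode_value; under eq_bigr do rewrite qQ mulrDr.
  rewrite big_split /= -mulr_suml loop_weight_sum1 mul1r -lerBrDr.
  rewrite (le_trans _ (leV c x)) // qf_adjoint sum_draw exchange_big /= le_eqVlt.
  apply/orP; left; apply/eqP; apply: eq_bigr => g _; rewrite qfK mulr_sumr.
  apply: eq_bigr => e _; rewrite mulr_sumr; apply: eq_bigr => l _.
  have := loop_weight_mode_energy c g e; set m := mode_energy_prob _ _ _ => wm.
  by rewrite -[X in X * trans _ _ _]/m /step_prob -wm !mulrA.
(* After removal of d I, both sides average over the next energy and latent state with the same
   weights, so [VQ] applies term by term. *)
have feas s x : qf (\sum_s' psi u s' s *: Q s') (plant_mx Sys s.1.2 *m x)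
    <= qf (Q s) x - d * sqnorm2 x.
  rewrite qQ addrK qf_psi_sum qfK; apply: ler_sum => e _; apply: ler_sum => l _.
  by rewrite ler_wpM2l // mulr_ge0 ?mode_energy_prob_ge0 ?trans_ge0.
(* The constraints are homogeneous in the matrices and v, so scaling by D / d turns the margin d
   into D. *)
exists (fun s => (D / d) *: Q s); apply/sdp_feasibleP; split=> // [s|s x].
  by apply: psdZ; rewrite ?divr_ge0 ?ltW.
have -> : \sum_s' psi u s' s *: (D / d *: Q s') =
    (D / d) *: \sum_s' psi u s' s *: Q s'.
  by rewrite scaler_sumr; apply: eq_bigr => s' _; rewrite !scalerA mulrC.
have -> : - D * sqnorm2 x = - (D / d * (d * sqnorm2 x)) by rewrite mulrA divfK ?gt_eqF ?mulNr.
rewrite !qfZ -mulrBr.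
by apply: ler_wpM2l (feas s x); rewrite divr_ge0 ?ltW.
Qed.

(** An infimum equal to -D is negative, so some feasible v is negative, whether or not the infimum
    is attained. Conversely -D is a lower bound by the last constraint, and it is attained by
    scaling. *)
Lemma sdp_value_lyapunov D : 0 < D -> sdp_value u D = (- D)%:E <-> lyapunov.
Proof.
move=> D0; split=> [val|lyap]; last first.
  have [Q fQ] := feasible_of_lyapunov D0 lyap; apply/eqP; rewrite eq_le.
  apply/andP; split; first by apply: ereal_inf_lbound; exists (- D) => //; exists Q.
  by apply: le_ereal_inf_tmp => _ [v [Q' [_ _ vD]] <-]; rewrite lee_fin.
have : (sdp_value u D < 0)%E by rewrite val lte_fin oppr_lt0.
move=> /ereal_inf_lt[_ [v [Q fQ] <-]]; rewrite lte_fin.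
exact: lyapunov_of_feasible fQ.
Qed.

End Lyapunov.

(** * Factorization of positive definite matrices *)

(** Induction on the size: split off the first row and column, and factor the Schur complement [C']
    of the corner entry. *)
Lemma pd_cholesky (R : realType) (n : nat) (W : 'M[R]_n) :
  pdmx W -> exists B : 'M[R]_n, W = B *m B^T.
Proof.
elim: n W => [|n IH] W; first by move=> _; exists 0; apply/matrixP => -[].
move=> [Ws Wpd].
pose W' : 'M[R]_(1 + n) := W.
pose a : R := ulsubmx W' 0 0; pose b := dlsubmx W'; pose C := drsubmx W'.
have Wb : W' = block_mx a%:M b^T b C.
  rewrite -[LHS]submxK /a /b -mx11_scalar; congr block_mx.
  by rewrite trmx_dlsub; congr ursubmx.
have Cs : C^T = C by rewrite trmx_drsub; congr drsubmx.
have qW (t : R) (y : 'cV[R]_n) : bf W' (col_mx t%:M y) (col_mx t%:M y) =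
    a * t ^+ 2 + 2 * t * (b^T *m y) 0 0 + qf C y.
  have yb : (y^T *m b) 0 0 = (b^T *m y) 0 0.
    by rewrite -[in RHS](trmxK (b^T *m y)) [RHS]mxE trmx_mul trmxK.
  rewrite /bf Wb tr_col_mx mul_row_block mul_row_col !mulmxDl tr_scalar_mx.
  rewrite !mul_scalar_mx !mul_mx_scalar -!scalemxAl.
  have ED (M N : 'M[R]_1) : (M + N) 0 0 = M 0 0 + N 0 0 by rewrite mxE.
  have EZ c (M : 'M[R]_1) : (c *: M) 0 0 = c * M 0 0 by rewrite mxE.
  rewrite !ED !EZ yb -/(bf C y y) -/(qf C y) [X in t * (t * X)]mxE eqxx mulr1n.
  ring.
have a0 : 0 < a.
  have := Wpd (col_mx (1%:M : 'M[R]_1) (0 : 'cV[R]_n)); rewrite -/(bf W' _ _) qW mulmx0 mxE mulr0 addr0.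
  rewrite expr1n mulr1 /qf /bf mulmx0 mxE addr0; apply; apply/eqP.
  move=> /(congr1 (@usubmx _ 1 n 1)); rewrite col_mxKu linear0.
  by move/matrixP => /(_ 0 0)/eqP; rewrite !mxE eqxx oner_eq0.
pose s := Num.sqrt a; have s2 : s * s = a by rewrite -expr2 sqr_sqrtr ?ltW.
have s0 : s != 0 by rewrite gt_eqF ?sqrtr_gt0.
pose C' := C - a^-1 *: (b *m b^T).
have C's : C'^T = C' by rewrite /C' linearB linearZ /= trmx_mul trmxK Cs.
have qC' y : qf C' y = qf C y - a^-1 * (b^T *m y) 0 0 ^+ 2.
  rewrite qfB qfZ; congr (_ - _ * _).
  rewrite /qf /bf mulmxA -mulmxA [LHS]mxE big_ord1 expr2; congr (_ * _).
  by rewrite -[in RHS](trmxK (b^T *m y)) [RHS]mxE trmx_mul trmxK.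
have [|L LE] := IH C'; first split=> // y y0.
  (* For given y this first coordinate minimizes the form of [W], and the minimum is the form of the
     Schur complement at y. *)
  have := Wpd (col_mx ((- a^-1 * (b^T *m y) 0 0)%:M : 'M[R]_1) y).
  rewrite -/(bf W' _ _) qW -/(bf C' y y) -/(qf C' y) qC'.
  set z := (b^T *m y) 0 0 => h.
  have {h} : 0 < a * (- a^-1 * z) ^+ 2 + 2 * (- a^-1 * z) * z + qf C y.
    apply: h; apply: contraNN y0 => /eqP/(congr1 (@dsubmx _ 1 n 1)).
    by rewrite col_mxKd linear0 => ->.
  congr (_ < _); field; exact: lt0r_neq0.
pose B : 'M[R]_(1 + n) := block_mx s%:M 0 (s^-1 *: b) L.
exists B; suff: W' = B *m B^T by [].
rewrite Wb tr_block_mx mulmx_block trmx0 !mulmx0 !mul0mx !addr0.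
rewrite tr_scalar_mx -scalar_mxM s2 linearZ /= mul_scalar_mx mul_mx_scalar.
rewrite !scalerA mulfV // !scale1r -scalemxAl -scalemxAr scalerA -invfM s2.
by rewrite -LE /C' addrC subrK.
Qed.

(** * Measures and integrals along finite-valued maps *)

Lemma setT_fibres (T I : Type) (h : T -> I) :
  [set: T] = \bigcup_(i in [set: I]) [set w | h w = i].
Proof. by apply/seteqP; split=> w //= _; exists (h w). Qed.

Section FiniteFibres.
Context d (T : measurableType d) (R : realType) (I : finType) (h : T -> I).
Hypothesis mh : forall i, measurable [set w | h w = i].

Lemma measurable_fin_set (Q : T -> I -> Prop) :
  (forall i, measurable [set w | Q w i]) -> measurable [set w | Q w (h w)].
Proof.
move=> mQ.
have -> : [set w | Q w (h w)] = \bigcup_(i in [set: I]) ([set w | h w = i] `&` [set w | Q w i]).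
  apply/seteqP; split=> [w /= Qw|w [i _ [/= <-]] //]; by exists (h w).
by apply: fin_bigcup_measurable => // i _; exact: measurableI.
Qed.

Lemma measurable_fun_fin d' (T' : measurableType d') (F : I -> T -> T') :
  (forall i, measurable_fun setT (F i)) -> measurable_fun setT (fun w => F (h w) w).
Proof.
move=> mF _ Y mY; rewrite setTI.
apply: (@measurable_fin_set (fun w i => Y (F i w))) => i.
by have := mF i measurableT Y mY; rewrite setTI.
Qed.

Lemma measure_fibres (P : {measure set T -> \bar R}) (A : set T) : measurable A ->
  P A = (\sum_i P (A `&` [set w | h w = i]))%E.
Proof.
move=> mA; have {1}-> : A = \bigcup_(i in [set: I]) (A `&` [set w | h w = i]).
  by rewrite -setI_bigcupr -setT_fibres setIT.
have mAi i : [set: I] i -> measurable (A `&` [set w | h w = i]) by move=> _; exact: measurableI.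
have tAi : trivIset [set: I] (fun i => A `&` [set w | h w = i]).
  by move=> i j _ _ [w [[_ /= <-] [_ /= <-]]].
have allI : [set: I] = [set` enum I].
  by apply/seteqP; split=> i _ //=; rewrite mem_enum.
rewrite (measure_fin_bigcup P (finite_finset (X := setT)) tAi mAi) allI.
by rewrite -fsbig_seq ?enum_uniq // big_enum.
Qed.

Lemma integral_fibres (P : {measure set T -> \bar R}) (f : T -> R) :
  measurable_fun setT f ->
  (\int[P]_w (f w)%:E = \sum_i \int[P]_(w in [set w | h w = i]) (f w)%:E)%E.
Proof.
move=> mf; pose F i := [set w | h w = i].
have E : [set: T] = \big[setU/set0]_(i <- enum I) F i.
  apply/seteqP; split=> // w _; rewrite -bigcup_seq.
  by exists (h w) => //=; rewrite mem_enum.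
rewrite {1}E integral_bigsetU_EFin ?enum_uniq -?E //; first by rewrite big_enum.
  by move=> i j _ _ [w [/= <- /= <-]].
exact/measurable_EFinP.
Qed.

Lemma integral_fin (P : {measure set T -> \bar R}) (g : I -> R) :
  (\int[P]_w (g (h w))%:E = \sum_i (g i)%:E * P [set w | h w = i])%E.
Proof.
rewrite integral_fibres; last first.
  exact: (measurable_fun_fin (F := fun i _ => g i)).
apply: eq_bigr => i _; rewrite -integral_cst //.
by apply: eq_integral => w; rewrite inE /= => ->.
Qed.

End FiniteFibres.

(** The hypothesis makes the law of [f1] on [S1] equal to [c] times the law of [f2] on [S2]; the
    claim compares their means. It turns statements about events, such as [step_law], into
    statements about integrals. *)
Lemma proportional_integral d (T : measurableType d) (R : realType)
    (P : probability T R) (S1 S2 : set T) (f1 f2 : T -> R) (c : R) :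
  measurable S1 -> measurable S2 ->
  measurable_fun setT f1 -> measurable_fun setT f2 ->
  (forall w, 0 <= f1 w) -> (forall w, 0 <= f2 w) -> 0 <= c ->
  (forall C, measurable C ->
    P (f1 @^-1` C `&` S1) = c%:E * P (f2 @^-1` C `&` S2))%E ->
  (\int[P]_(w in S1) (f1 w)%:E = c%:E * \int[P]_(w in S2) (f2 w)%:E)%E.
Proof.
move=> mS1 mS2 mf1 mf2 f10 f20 c0 Pc.
(* The law of [f] restricted to [S] is that of [f * \1_S] away from 0. *)
pose g f S (w : T) : R := f w * \1_S w.
pose D : set R := [set y | 0 < y].
have mD : measurable D by rewrite -[D]set_itvoy; exact: measurable_itv.
have mg f S : measurable_fun setT f -> measurable S -> measurable_fun setT (g f S).
  by move=> mf mS; apply: measurable_funM => //; exact: measurable_indic.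
have gP f S C : C `<=` D -> g f S @^-1` C = f @^-1` C `&` S.
  move=> CD; apply/seteqP; split=> w /=; rewrite /g indicE.
    case: (boolP (w \in S)) => wS; rewrite ?mulr1 ?mulr0.
      by split=> //; rewrite inE in wS.
    by move=> /CD /=; rewrite /D /= ltxx.
  by move=> [Cw Sw]; rewrite mem_set ?mulr1.
have intg (f : T -> R) (S : set T) : measurable_fun setT f -> measurable S -> (forall w, 0 <= f w) ->
    (\int[P]_(w in S) (f w)%:E = \int[pushforward P (g f S)]_(y in D) y%:E)%E.
  move=> mf mS f0.
  have D0 : {in D, forall y : R, 0 <= y%:E}%E by move=> y; rewrite inE lee_fin => /ltW.
  rewrite (ge0_integral_pushforward (mg f S mf mS) P mD (@EFin_measurable _ D) D0).
  rewrite (gP f S D) // [LHS]integral_mkcond [RHS]integral_mkcond.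
  apply: eq_integral => w _; rewrite !patchE in_setI.
  case: (boolP (w \in S)) => wS; rewrite ?andbF // andbT /g /= indicE wS mulr1.
  case: ifPn => //; rewrite notin_setE /= /D /= => /negP; rewrite -leNgt => fw.
  by congr (_%:E); apply/eqP; rewrite eq_le fw f0.
rewrite !intg //.
pose G (f : T -> R) (S : set T) (mf : measurable_fun setT f) (mS : measurable S) : {mfun T >-> R} :=
  HB.pack (g f S) (isMeasurableFun.Build _ _ _ _ (g f S) (mg f S mf mS)).
pose k : {nonneg R} := NngNum c0.
have -> : (\int[pushforward P (g f1 S1)]_(y in D) y%:E =
    \int[mscale k (distribution P (G f2 S2 mf2 mS2))]_(y in D) y%:E)%E.
  apply: (@eq_measure_integral _ _ _ _ _ (distribution P (G f1 S1 mf1 mS1))) => A mA AD.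
  transitivity (P (f1 @^-1` A `&` S1)); first by rewrite -gP.
  by rewrite Pc // -gP.
rewrite ge0_integral_mscale // => y; first by move=> /ltW; rewrite lee_fin.
Qed.

(** * Measurability of random vectors, by coordinates *)

Section MeasurableVector.
Context d (T : measurableType d) (R : realType).

Definition measurable_vec n (y : T -> 'cV[R]_n) : Prop :=
  forall i, measurable_fun setT (fun w => y w i 0).

Lemma measurable_vecD n (y z : T -> 'cV[R]_n) : measurable_vec y -> measurable_vec z ->
  measurable_vec (fun w => y w + z w).
Proof.
move=> my mz i; rewrite (_ : (fun w => _) = (fun w => y w i 0) \+ (fun w => z w i 0)).
  exact: measurable_funD.
by apply/funext => w; rewrite mxE.
Qed.

Lemma measurable_vec_mulmx m n (A : 'M[R]_(m, n)) (y : T -> 'cV[R]_n) :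
  measurable_vec y -> measurable_vec (fun w => A *m y w).
Proof.
move=> my i; under [X in measurable_fun _ X]eq_fun do rewrite mxE.
by apply: measurable_sum => j; apply: measurable_funM.
Qed.

Lemma measurable_qf n (V : 'M[R]_n) (y : T -> 'cV[R]_n) :
  measurable_vec y -> measurable_fun setT (fun w => qf V (y w)).
Proof.
move=> my; under [X in measurable_fun _ X]eq_fun do rewrite qfE.
apply: measurable_sum => i; apply: measurable_sum => j.
by apply: measurable_funM => //; exact: measurable_funM.
Qed.

End MeasurableVector.

(** * The past of a realization and its one-step laws *)

Section PastMeasurability.
Context {R : realType} {n : nat} {Lat : finType} {Hmax : nat}.
Variables (Sys : ehcs R n Lat Hmax) (u : policy Sys) (W : 'M[R]_n).
Context d (T : measurableType d) (P : probability T R) (X : processes Sys T).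
Hypothesis RX : realization u W P X.

Definition config_at t (w : T) : config Sys := (bat X t w, lat X t w, hist X t w).
Definition draw_at t (w : T) : draw Sys := (ener X t w, loop X t w, lat X t.+1 w).

(* [response 1] is the plant process, and [response 0] the process without
   disturbances that starts at the same initial state. *)
Fixpoint response (c : R) t (w : T) : 'cV[R]_n :=
  if t is s.+1 then plant_mx Sys (loop X s w) *m response c s w + c *: noise X s w
  else plant X 0 w.

Lemma response1 t w : response 1 t w = plant X t w.
Proof. by elim: t => //= t ->; rewrite (plant_dyn RX) scale1r. Qed.

Lemma config_atS t w : config_at t.+1 w = next_config (config_at t w) (draw_at t w).
Proof. by rewrite /config_at (bat_dyn RX) (hist_dyn RX). Qed.

Local Notation past_type t := (g_sigma_algebraType (past_event X t)).

Lemma past_measurable_set t A : past X t A -> measurable A.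
Proof.
apply: smallest_sub; first exact: sigma_algebra_measurable.
exact: past_measurable RX t.
Qed.

Lemma past_eventS t A : past_event X t A -> past_event X t.+1 A.
Proof.
by case=> *; constructor => //; apply/leqW.
Qed.

Lemma pastS t A : past X t A -> past X t.+1 A.
Proof. by apply: sub_sigma_algebra2; exact: past_eventS. Qed.

Lemma past_gen t A : past_event X t A -> measurable (A : set (past_type t)).
Proof. exact: sub_sigma_algebra. Qed.

Lemma past_measurable_fun t d' (T' : measurableType d') (f : T -> T') :
  measurable_fun (setT : set (past_type t)) f -> measurable_fun setT f.
Proof.
by move=> mf _ Y mY; apply: past_measurable_set (mf measurableT Y mY).
Qed.

Lemma past_funS t d' (T' : measurableType d') (f : T -> T') :
  measurable_fun (setT : set (past_type t)) f ->
  measurable_fun (setT : set (past_type t.+1)) f.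
Proof. by move=> mf _ Y mY; apply: pastS (mf measurableT Y mY). Qed.

Lemma past_draw t e g : past X t.+1 [set w | ener X t w = e /\ loop X t w = g].
Proof.
apply: (@measurableI _ (past_type t.+1)); apply: past_gen.
  exact: past_ener.
exact: past_loop.
Qed.

(** Only the initial battery level and history value generate the past directly; the later ones
    follow by induction, being functions of the preceding configuration and energy. *)
Lemma past_config t c : past X t [set w | config_at t w = c].
Proof.
have split3 s b l f : past X s [set w | bat X s w = b] ->
    past X s [set w | hist X s w = f] ->
    past X s [set w | config_at s w = (b, l, f)].
  move=> pb pf; have -> : [set w | config_at s w = (b, l, f)] =
     [set w | bat X s w = b] `&` [set w | lat X s w = l] `&` [set w | hist X s w = f].
    apply/seteqP; split=> w /=; first by case=> <- <- <-.
    by move=> [[<- <-] <-].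
  do 2 apply: (@measurableI _ (past_type s)) => //.
  by apply: past_gen; exact: past_lat.
case: c => [[b l] f]; elim: t b l f => [|t IH] b l f; apply: split3.
- by apply: past_gen; constructor.
- by apply: past_gen; constructor.
- rewrite (_ : [set w | _] = [set w | next_level (config_at t w).1.1 (config_at t w).1.2
      (ener X t w) = b]); last by apply/seteqP; split=> w /=; rewrite (bat_dyn RX).
  apply: (@measurable_fin_set _ (past_type t.+1) _ (config_at t) _
    (fun w (c : config Sys) => next_level c.1.1 c.1.2 (ener X t w) = b)) => [[[b' l'] f']|c].
    exact: pastS (IH b' l' f').
  apply: (@measurable_fin_set _ (past_type t.+1) _ (ener X t) _
    (fun w e => next_level c.1.1 c.1.2 e = b)) => [e|e].
    by apply: past_gen; exact: past_ener.
  have [->|ne] := pselect (next_level c.1.1 c.1.2 e = b).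
    rewrite (_ : [set _ | _] = setT); last by apply/seteqP; split.
    exact: (@measurableT _ (past_type t.+1)).
  rewrite (_ : [set _ | _] = set0); last by apply/seteqP; split=> w /=; [move/ne|].
  exact: (@measurable0 _ (past_type t.+1)).
- rewrite (_ : [set w | _] = [set w | transmits (ener X t w) = f]);
    last by apply/seteqP; split=> w /=; rewrite (hist_dyn RX).
  apply: (@measurable_fin_set _ (past_type t.+1) _ (ener X t) _
    (fun w e => transmits e = f)) => [e|e].
    by apply: past_gen; exact: past_ener.
  have [->|ne] := pselect (transmits e = f).
    rewrite (_ : [set _ | _] = setT); last by apply/seteqP; split.
    exact: (@measurableT _ (past_type t.+1)).
  rewrite (_ : [set _ | _] = set0); last by apply/seteqP; split=> w /=; [move/ne|].
  exact: (@measurable0 _ (past_type t.+1)).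
Qed.

Lemma past_noise_vec t : @measurable_vec _ (past_type t.+1) R n (noise X t).
Proof.
by move=> i _ C mC; rewrite setTI; apply: past_gen; exact: past_noise.
Qed.

Lemma past_response c t : @measurable_vec _ (past_type t) R n (response c t).
Proof.
elim: t => [|t IH].
  by move=> i _ C mC; rewrite setTI; apply: past_gen; exact: past_plant.
apply: measurable_vecD; last first.
  move=> i; rewrite (_ : (fun w => _) = (fun w => c * noise X t w i 0)).
    by apply: measurable_funM => //; exact: past_noise_vec.
  by apply/funext => w; rewrite mxE.
move=> i; apply: (@measurable_fun_fin _ (past_type t.+1) _ (loop X t) _ _ _
  (fun g w => (plant_mx Sys g *m response c t w) i 0)) => g.
  by apply: past_gen; exact: past_loop.
by apply: measurable_vec_mulmx => j; exact: past_funS (IH j).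
Qed.

Lemma measurable_config t c : measurable [set w | config_at t w = c].
Proof. apply: (@past_measurable_set t); exact: past_config. Qed.

Lemma measurable_loop t g : measurable [set w | loop X t w = g].
Proof.
by apply: (@past_measurable_set t.+1); apply: sub_sigma_algebra; exact: past_loop.
Qed.

Lemma measurable_draw t o : measurable [set w | draw_at t w = o].
Proof.
case: o => [[e g] l]; rewrite (_ : [set w | _] =
  [set w | ener X t w = e /\ loop X t w = g] `&` [set w | lat X t.+1 w = l]).
  apply: (@past_measurable_set t.+1); apply: (@measurableI _ (past_type t.+1)).
    exact: past_draw.
  by apply: past_gen; exact: past_lat.
by apply/seteqP; split=> w /=; [case=> <- <- <-|case=> -[<- <-] <-].
Qed.

Lemma measurable_config_draw t c : measurable [set w | (config_at t w, draw_at t w) = c].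
Proof.
case: c => c o; rewrite (_ : [set w | _] =
   [set w | config_at t w = c] `&` [set w | draw_at t w = o]).
  by apply: measurableI; [exact: measurable_config|exact: measurable_draw].
by apply/seteqP; split=> w /=; [case=> <- <-|case=> <- <-].
Qed.

Lemma step_law_config t A c o (C : 'I_n -> set R) : past X t A ->
  (forall i, measurable (C i)) ->
  (P (A `&` [set w | in_box (noise X t w) C] `&`
     [set w | (config_at t w, draw_at t w) = (c, o)]) =
   (step_prob u c o)%:E * P [set w | in_box (noise X 0 w) C] *
   P (A `&` [set w | config_at t w = c]))%E.
Proof.
case: c o => [[b l] f] [[e g] l'] pA mC.
rewrite /step_prob /= (_ : [set w | config_at t w = _] =
  [set w | [/\ bat X t w = b, lat X t w = l & hist X t w = f]]); last first.
  by apply/seteqP; split=> w /=; [case=> <- <- <-|case=> <- <- <-].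
rewrite -(step_law RX pA b l f e g l' mC); congr (P _).
apply/seteqP; split=> w /=.
  by case=> -[Aw Nw] [<- <- <- <- <- <-].
by case=> -[Aw [<- <- <-]] [<- <- Nw <-].
Qed.

(** The draw is independent of the past given the configuration: [step_law] is applied to the
    preimages under [f], which are past events, with no restriction on the disturbance. *)
Lemma one_step t c o (f : T -> R) :
  measurable_fun (setT : set (past_type t)) f -> (forall w, 0 <= f w) ->
  (\int[P]_(w in [set w | (config_at t w, draw_at t w) = (c, o)]) (f w)%:E =
   (step_prob u c o)%:E * \int[P]_(w in [set w | config_at t w = c]) (f w)%:E)%E.
Proof.
move=> mf f0; apply: proportional_integral => //.
- exact: measurable_config_draw.
- exact: measurable_config.
- exact: past_measurable_fun mf.
- exact: past_measurable_fun mf.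
- exact: step_prob_ge0.
move=> C mC; have pA : past X t (f @^-1` C).
  by have := mf measurableT C mC; rewrite setTI.
have boxT s : [set w | in_box (noise X s w) (fun _ => setT)] = setT by apply/seteqP.
have := step_law_config c o pA (fun _ : 'I_n => @measurableT _ R).
by rewrite !boxT setIT probability_setT mule1.
Qed.

(** A marginal of [step_law]: take a box that restricts only coordinate [i], and sum over all
    configurations and draws, whose probabilities add up to one. *)
Lemma noise_law t i C : measurable C ->
  P [set w | C (noise X t w i 0)] = P [set w | C (noise X 0 w i 0)].
Proof.
move=> mC; pose B j : set R := if j == i then C else setT.
have mB j : measurable (B j) by rewrite /B; case: ifP.
have boxB s : [set w | C (noise X s w i 0)] = [set w | in_box (noise X s w) B].
  apply/seteqP; split=> w /= Cw; last by have := Cw i; rewrite /B eqxx.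
  by move=> j; rewrite /B; case: eqP => // ->.
have pT : past X t setT by exact: (@measurableT _ (past_type t)).
rewrite !boxB (measure_fibres (measurable_config_draw t)); last first.
  rewrite -boxB; apply: (@past_measurable_set t.+1); apply: sub_sigma_algebra.
  exact: past_noise.
transitivity (\sum_c \sum_o ((step_prob u c o)%:E * P [set w | in_box (noise X 0 w) B] *
    P [set w | config_at t w = c]))%E.
  rewrite pair_bigA /=; apply: eq_bigr => -[c o] _ /=.
  by have := step_law_config c o pT mB; rewrite !setTI => ->.
transitivity (\sum_c (P [set w | in_box (noise X 0 w) B] *
    P [set w | config_at t w = c]))%E.
  apply: eq_bigr => c _; under eq_bigr do rewrite -muleA.
  rewrite -ge0_sume_distrl; last by move=> o _; rewrite lee_fin step_prob_ge0.
  by rewrite sumEFin step_prob_sum1 mul1e.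
rewrite -ge0_sume_distrr //.
transitivity (P [set w | in_box (noise X 0 w) B] * P setT)%E; last first.
  by rewrite probability_setT mule1.
congr (_ * _)%E; rewrite (measure_fibres (measurable_config t) P measurableT).
by apply: eq_bigr => c _; rewrite setTI.
Qed.

Lemma measurable_noise t : measurable_vec (noise X t).
Proof. by move=> i; apply: (@past_measurable_fun t.+1); exact: past_noise_vec. Qed.

Lemma measurable_response c t : measurable_vec (response c t).
Proof. by move=> i; apply: (@past_measurable_fun t); exact: past_response. Qed.

Lemma past_plant_vec t : @measurable_vec _ (past_type t) R n (plant X t).
Proof.
move=> i; rewrite (_ : (fun w => _) = (fun w => response 1 t w i 0)).
  exact: past_response.
by apply/funext => w; rewrite response1.
Qed.

Lemma measurable_plant t : measurable_vec (plant X t).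
Proof. by move=> i; apply: (@past_measurable_fun t); exact: past_plant_vec. Qed.

(** Each coordinate has the same law as at time 0, where the diagonal of [W] gives its second
    moment. *)
Lemma noise_square t : (\int[P]_w (sqnorm2 (noise X t w))%:E = (\tr W)%:E)%E.
Proof.
have m2 s i : measurable_fun setT (fun w => noise X s w i 0 ^+ 2).
  by rewrite (_ : (fun w => _) = (fun w => noise X s w i 0) \* (fun w => noise X s w i 0));
    [exact: measurable_funM (measurable_noise s i) (measurable_noise s i)|].
have coord i : (\int[P]_w (noise X t w i 0 ^+ 2)%:E = (W i i)%:E)%E.
  rewrite -(noise_moment RX i i) unlock; under [RHS]eq_integral do rewrite -expr2.
  rewrite -[RHS]mul1e; apply: proportional_integral => // [w|w|C mC].
  - exact: sqr_ge0.
  - exact: sqr_ge0.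
  rewrite mul1e !setIT.
  have mC2 : measurable ((fun y : R => y ^+ 2) @^-1` C).
    have := @exprn_measurable R setT 2 => /(_ measurableT C mC).
    by rewrite setTI.
  exact: noise_law t i _ mC2.
rewrite /sqnorm2 (_ : (fun w => _) = (fun w => \sum_i (noise X t w i 0 ^+ 2)%:E))%E;
  last by apply/funext => w; rewrite sumEFin.
rewrite ge0_integral_sum //; last 2 first.
- by move=> i; apply/measurable_EFinP.
- by move=> i w _; rewrite lee_fin sqr_ge0.
by rewrite /mxtrace -sumEFin; apply: eq_bigr => i _; rewrite coord.
Qed.

Lemma measurable_config_qf t (V : config Sys -> 'M[R]_n) (y : T -> 'cV[R]_n) :
  measurable_vec y -> measurable_fun setT (fun w => qf (V (config_at t w)) (y w)).
Proof.
move=> my; apply: (measurable_fun_fin (measurable_config t)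
  (F := fun c w => qf (V c) (y w))) => c.
exact: measurable_qf.
Qed.

(** The integral is cut along configuration and draw, and [one_step] replaces each draw by its
    probability. As [y] is any vector determined by the past, this serves both the plant and its
    disturbance-free response. *)
Lemma past_drift t (V : config Sys -> 'M[R]_n) (y : T -> 'cV[R]_n) :
  @measurable_vec _ (past_type t) R n y -> (forall c, psdmx (V c)) ->
  (\int[P]_w (qf (V (config_at t.+1 w)) (plant_mx Sys (loop X t w) *m y w))%:E =
   \int[P]_w (qf (adjoint u V (config_at t w)) (y w))%:E)%E.
Proof.
move=> py pV.
have my : measurable_vec y by move=> i; apply: (@past_measurable_fun t); exact: py.
pose q (c : config Sys * draw Sys) w :=
  qf (V (next_config c.1 c.2)) (plant_mx Sys c.2.1.2 *m y w).
have pq c : measurable_fun (setT : set (past_type t)) (q c).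
  by apply: measurable_qf; exact: measurable_vec_mulmx.
have mq c : measurable_fun setT (q c).
  by apply: (@past_measurable_fun t); exact: pq.
have q0 c w : 0 <= q c w by exact: psd_qf_ge0.
transitivity (\int[P]_w (q (config_at t w, draw_at t w) w)%:E)%E.
  by apply: eq_integral => w _; rewrite /q /= config_atS.
have mqc : measurable_fun setT (fun w => q (config_at t w, draw_at t w) w).
  exact: (@measurable_fun_fin _ _ _ _ (measurable_config_draw t) _ _ q mq).
rewrite (integral_fibres (measurable_config_draw t) P mqc).
rewrite (integral_fibres (measurable_config t) P); last exact: measurable_config_qf.
transitivity (\sum_c \sum_o ((step_prob u c o)%:E *
   \int[P]_(w in [set w | config_at t w = c]) (q (c, o) w)%:E))%E.
  rewrite pair_bigA /=; apply: eq_bigr => -[c o] _.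
  rewrite -one_step //; apply: eq_integral => w; rewrite inE /= => -[-> ->] //.
apply: eq_bigr => c _.
have mC := measurable_config t c.
transitivity (\sum_o \int[P]_(w in [set w | config_at t w = c])
    ((step_prob u c o)%:E * (q (c, o) w)%:E))%E.
  apply: eq_bigr => o _; rewrite ge0_integralZl_EFin ?step_prob_ge0 //.
    by move=> w _; rewrite lee_fin.
  by apply/measurable_EFinP; exact: measurable_funTS.
rewrite -ge0_integral_sum //; last 2 first.
- move=> o; apply/measurable_EFinP; apply: measurable_funM => //.
  exact: measurable_funTS.
- by move=> o w _; rewrite mule_ge0 ?lee_fin ?step_prob_ge0.
apply: eq_integral => w; rewrite inE /= => ->.
by rewrite qf_adjoint -sumEFin.
Qed.

End PastMeasurability.

(** * Integrals of nonnegative real functions *)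

Section RealIntegral.
Context d (T : measurableType d) (R : realType) (P : {measure set T -> \bar R}).
Variables f g : T -> R.
Hypotheses (mf : measurable_fun setT f) (mg : measurable_fun setT g).
Hypotheses (f0 : forall w, 0 <= f w) (g0 : forall w, 0 <= g w).

Lemma le_integral_real : (forall w, f w <= g w) ->
  (\int[P]_w (f w)%:E <= \int[P]_w (g w)%:E)%E.
Proof.
move=> fg; apply: ge0_le_integral => //; try exact/measurable_EFinP.
all: by move=> w _; rewrite lee_fin.
Qed.

Lemma integral_lin (a b : R) : 0 <= a -> 0 <= b ->
  (\int[P]_w (a * f w + b * g w)%:E =
   a%:E * \int[P]_w (f w)%:E + b%:E * \int[P]_w (g w)%:E)%E.
Proof.
move=> a0 b0.
have Z (h : T -> R) c : measurable_fun setT h -> (forall w, 0 <= h w) -> 0 <= c ->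
    (\int[P]_w (c * h w)%:E = c%:E * \int[P]_w (h w)%:E)%E.
  move=> mh h0 c0; rewrite -ge0_integralZl_EFin //.
    by move=> w _; rewrite lee_fin.
  exact/measurable_EFinP.
rewrite -!Z // -ge0_integralD //; try (by move=> w _; rewrite lee_fin mulr_ge0).
all: by apply/measurable_EFinP; exact: measurable_funM.
Qed.

Lemma integralZ_real (a : R) : 0 <= a ->
  (\int[P]_w (a * f w)%:E = a%:E * \int[P]_w (f w)%:E)%E.
Proof.
move=> a0; rewrite -ge0_integralZl_EFin //.
  by move=> w _; rewrite lee_fin.
exact/measurable_EFinP.
Qed.

End RealIntegral.

Lemma measurable_sqnorm2 d (T : measurableType d) (R : realType) n (y : T -> 'cV[R]_n) :
  measurable_vec y -> measurable_fun setT (fun w => sqnorm2 (y w)).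
Proof.
move=> /(measurable_qf 1%:M); congr (measurable_fun _ _).
by apply/funext => w; rewrite qf1.
Qed.

(** * The Lyapunov condition implies stability *)

Section Sufficiency.
Context {R : realType} {n : nat} {Lat : finType} {Hmax : nat}.
Variables (Sys : ehcs R n Lat Hmax) (u : policy Sys) (W : 'M[R]_n).

Lemma qf_bound (V : config Sys -> 'M[R]_n) :
  exists2 K, 0 <= K & forall c x, qf (V c) x <= K * sqnorm2 x.
Proof.
pose k c := \sum_i \sum_j `|V c i j|.
have k0 c : 0 <= k c by apply: sumr_ge0 => i _; apply: sumr_ge0.
exists (\sum_c k c); first by apply: sumr_ge0.
move=> c x; apply: (le_trans (qf_le_sqnorm2 _ _)); rewrite ler_wpM2r ?sqnorm2_ge0 //.
by rewrite (bigD1 c) //= lerDl; apply: sumr_ge0.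
Qed.

(** The decrease e |x|^2 is at least a fixed fraction of the form, which is bounded by a multiple of
    |x|^2. The lower bound on the form holds because the adjoint is positive semidefinite. *)
Lemma lyapunov_contraction : lyapunov u -> exists (V : config Sys -> 'M[R]_n) e K q,
  [/\ 0 < e <= K, 0 < q <= 1, forall c, psdmx (V c) &
    forall c x, [/\ e * sqnorm2 x <= qf (V c) x, qf (V c) x <= K * sqnorm2 x &
      qf (adjoint u V c) x <= (1 - q) * qf (V c) x]].
Proof.
move=> [e [V [e0 pV leV]]]; have [K K0 VK] := qf_bound V.
(* Adding [e] to the bound [K] makes it positive and ensures e / L <= 1. *)
pose L := e + K; have L0 : 0 < L by rewrite ltr_pwDl.
exists V, e, L, (e / L); split=> //.
- by rewrite e0 lerDl.
- by rewrite divr_gt0 //= ler_pdivrMr // mul1r lerDl.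
move=> c x; have s0 := sqnorm2_ge0 x; have VL : qf (V c) x <= L * sqnorm2 x.
  by rewrite (le_trans (VK c x)) // ler_wpM2r // lerDr ltW.
split=> //.
  by rewrite -subr_ge0; apply: le_trans (leV c x); exact/psd_qf_ge0/psd_adjoint.
apply: (le_trans (leV c x)); rewrite mulrBl mul1r lerD2l lerN2 mulrAC.
by rewrite ler_pdivrMr // -mulrA ler_wpM2l ?(ltW e0) // mulrC.
Qed.

Lemma lyapunov_stable : lyapunov u -> stable u W.
Proof.
move=> /lyapunov_contraction[V [e [K [q [/andP[e0 eK] /andP[q0 q1] pV leV]]]]].
have K0 : 0 < K by exact: lt_le_trans eK.
(* Young's inequality with parameter q / 2 costs half of the contraction, as (1 + q/2) (1 - q) <= 1
   - q/2; [N] is the resulting factor of the disturbance. *)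
pose xi := 1 - q / 2; pose N := (1 + (q / 2)^-1) * K.
have N0 : 0 <= N by apply: mulr_ge0; [apply: addr_ge0 => //; rewrite invr_ge0; lra|lra].
have xi0 : 0 < xi by rewrite /xi; lra.
have xi1 : xi < 1 by rewrite /xi; lra.
(* K / e compares the form with |x|^2 at both ends, and division by q / 2 = 1 - xi sums the
   geometric series of disturbances. *)
exists (K / e), xi, (N / (q / 2) / e); split=> //.
- by rewrite ler_pdivlMr ?mul1r.
- by rewrite xi0.
- by apply: divr_ge0; [apply: divr_ge0 => //; lra|lra].
move=> d T P X RX _ t; rewrite unlock.
have mx s : measurable_vec (plant X s) by exact: measurable_plant RX s.
have mn s : measurable_vec (noise X s) by exact: measurable_noise RX s.
have trW : 0 <= \tr W.
  rewrite -lee_fin -(noise_square RX 0); apply: integral_ge0 => w _.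
  by rewrite lee_fin sqnorm2_ge0.
pose F s w := qf (V (config_at X s w)) (plant X s w).
have F0 s w : 0 <= F s w by exact: psd_qf_ge0.
have mF s : measurable_fun setT (F s) by exact: measurable_config_qf RX s V _ (mx s).
have step s : (\int[P]_w (F s.+1 w)%:E <=
    xi%:E * \int[P]_w (F s w)%:E + (N * \tr W)%:E)%E.
  pose G w := qf (V (config_at X s.+1 w)) (plant_mx Sys (loop X s w) *m plant X s w).
  pose H w := qf (V (config_at X s.+1 w)) (noise X s w).
  have G0 w : 0 <= G w by exact: psd_qf_ge0.
  have H0 w : 0 <= H w by exact: psd_qf_ge0.
  have mG : measurable_fun setT G.
    apply: (measurable_fun_fin (measurable_loop RX s)
      (F := fun g w => qf (V (config_at X s.+1 w)) (plant_mx Sys g *m plant X s w))).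
    move=> g; apply: (measurable_config_qf RX s.+1 V).
    exact: measurable_vec_mulmx (mx s).
  have mH : measurable_fun setT H by exact: measurable_config_qf RX s.+1 V _ (mn s).
  have q2 : 0 < q / 2 by lra.
  have qV : 0 <= (q / 2)^-1 by rewrite invr_ge0 ltW.
  (* The next state is split into its homogeneous part, measured by [G], and the disturbance,
     measured by [H]. *)
  apply: (@le_trans _ _ (\int[P]_w ((1 + q / 2) * G w + (1 + (q / 2)^-1) * H w)%:E)%E).
    apply: le_integral_real => //.
    - by apply: measurable_funD; exact: measurable_funM.
    - by move=> w; rewrite /F (plant_dyn RX) qf_young.
  have a1 : 0 <= 1 + q / 2 by lra.
  have a2 : 0 <= 1 + (q / 2)^-1 by lra.
  rewrite (integral_lin P mG mH G0 H0 a1 a2).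
  apply: leeD.
    apply: (@le_trans _ _ ((1 + q / 2)%:E * ((1 - q)%:E * \int[P]_w (F s w)%:E))%E).
      apply: lee_wpmul2l; first by rewrite lee_fin; lra.
      rewrite (past_drift RX (past_plant_vec RX (t := s)) pV) -integralZ_real //; last lra.
      apply: le_integral_real => //.
      - by apply: (measurable_config_qf RX s); exact: mx.
      - exact: measurable_funM.
      - by move=> w; exact/psd_qf_ge0/psd_adjoint.
      - by move=> w; have [] := leV (config_at X s w) (plant X s w).
    rewrite muleA -EFinM; apply: lee_wpmul2r.
      by apply: integral_ge0 => w _; rewrite lee_fin.
    by rewrite lee_fin /xi; nra.
  rewrite /N -mulrA EFinM; apply: lee_wpmul2l; first by rewrite lee_fin addr_ge0.
  rewrite EFinM -(noise_square RX s) -integralZ_real ?(ltW K0) ?(ltW e0) //.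
  - apply: le_integral_real => //.
    + by apply: measurable_funM => //; exact: measurable_sqnorm2 (mn s).
    + by move=> w; have [] := leV (config_at X s.+1 w) (noise X s w).
  - exact: measurable_sqnorm2 (mn s).
  - by move=> w; exact: sqnorm2_ge0.
have I0 s : (0 <= \int[P]_w (F s w)%:E)%E.
  by apply: integral_ge0 => w _; rewrite lee_fin.
have iter : (\int[P]_w (F t w)%:E <=
    (xi ^+ t)%:E * \int[P]_w (F 0%N w)%:E + (N / (q / 2) * \tr W)%:E)%E.
  elim: t => [|t IH].
    rewrite expr0 mul1e leeDl // lee_fin mulr_ge0 // divr_ge0 //; lra.
  apply: (le_trans (step t)).
  (* The constant is the fixed point of z -> xi z + N tr W. *)
  have -> : N / (q / 2) * \tr W = xi * (N / (q / 2) * \tr W) + N * \tr W.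
    by rewrite /xi; field; rewrite gt_eqF.
  rewrite [(xi * _ + _)%:E]EFinD addeA leeD2r // exprS EFinM -muleA [(xi * (_ * _))%:E]EFinM.
  rewrite -ge0_muleDr; last 2 first.
  - by rewrite mule_ge0 // lee_fin exprn_ge0 // ltW.
  - by rewrite lee_fin mulr_ge0 // divr_ge0 //; lra.
  by apply: lee_wpmul2l => //; rewrite lee_fin ltW.
have S0 s w : 0 <= sqnorm2 (plant X s w) by exact: sqnorm2_ge0.
have mS s := measurable_sqnorm2 (mx s).
have low : (e%:E * \int[P]_w (sqnorm2 (plant X t w))%:E <= \int[P]_w (F t w)%:E)%E.
  rewrite -integralZ_real ?(ltW K0) ?(ltW e0) //; apply: le_integral_real => //.
  - exact: measurable_funM.
  - by move=> w; rewrite mulr_ge0 // ltW.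
  - by move=> w; have [] := leV (config_at X t w) (plant X t w).
have up : (\int[P]_w (F 0%N w)%:E <= K%:E * \int[P]_w (sqnorm2 (plant X 0 w))%:E)%E.
  rewrite -integralZ_real ?(ltW K0) ?(ltW e0) //; apply: le_integral_real => //.
  - exact: measurable_funM.
  - by move=> w; have [] := leV (config_at X 0 w) (plant X 0 w).
have xit : (0 <= (xi ^+ t)%:E)%E by rewrite lee_fin exprn_ge0 // ltW.
have h := le_trans low (le_trans iter (leeD (lee_wpmul2l xit up) (lexx _))).
have e' : 0 <= e^-1 by rewrite invr_ge0 ltW.
have e'E : (0 <= (e^-1)%:E)%E by rewrite lee_fin.
move: (lee_wpmul2l e'E h).
have S00 : (0 <= \int[P]_w (sqnorm2 (plant X 0 w))%:E)%E.
  by apply: integral_ge0 => w _; rewrite lee_fin.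
rewrite muleA -EFinM mulVf ?gt_eqF // mul1e ge0_muleDr; last 2 first.
- by rewrite !mule_ge0 // lee_fin ltW.
- by rewrite lee_fin mulr_ge0 // divr_ge0 //; lra.
rewrite !muleA -!EFinM.
have -> : e^-1 * xi ^+ t * K = K / e * xi ^+ t by ring.
by have -> : e^-1 * (N / (q / 2) * \tr W) = N / (q / 2) / e * \tr W by ring.
Qed.

End Sufficiency.

(** * The unit interval as a probability space, and its tree of nested cells *)

Section UnitInterval.
Variable R : realType.

Definition unit_prob : set (measurableTypeR R) -> \bar R :=
  mrestr (@lebesgue_measure R) (measurable_itv `[0%R, 1%R[).

HB.instance Definition _ := Measure.on unit_prob.

Lemma unit_probT : unit_prob setT = 1%:E.
Proof.
by rewrite /unit_prob /mrestr setTI lebesgue_measure_itv /= lte_fin ltr01 oppr0 adde0.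
Qed.

HB.instance Definition _ := Measure_isProbability.Build _ _ _ unit_prob unit_probT.

End UnitInterval.

(* Paths list the outcomes with the latest one first; [weight p o] is the
   probability that [o] follows the path [p]. *)
Section Tree.
Context {R : realType} {O : finType}.
Variables (o0 : O) (weight : seq O -> O -> R).
Hypothesis weight_ge0 : forall p o, 0 <= weight p o.
Hypothesis weight_sum1 : forall p, \sum_o weight p o = 1.

(** The fraction of the cell of [p] that lies to the left of its child number k. *)
Definition cum p (k : nat) : R := \sum_(o | (enum_rank o < k)%N) weight p o.

Lemma cum0 p : cum p 0 = 0. Proof. exact: big_pred0. Qed.

Lemma cum_card p : cum p #|O| = 1.
Proof. by rewrite -[RHS](weight_sum1 p); apply: eq_bigl => o; rewrite ltn_ord. Qed.

Lemma cumS p o : cum p (enum_rank o).+1 = cum p (enum_rank o) + weight p o.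
Proof.
rewrite /cum (bigD1 o) //= addrC; congr (_ + _); apply: eq_bigl => o'.
by rewrite ltnS ltn_neqAle (inj_eq val_inj) (inj_eq enum_rank_inj) andbC.
Qed.

Lemma le_cum p j k : (j <= k)%N -> cum p j <= cum p k.
Proof.
move=> jk; rewrite /cum [leRHS](bigID (fun o => (enum_rank o < j)%N)) /=.
rewrite [X in _ <= X + _](eq_bigl (fun o => (enum_rank o < j)%N)).
  by rewrite lerDl; apply: sumr_ge0.
by move=> o; apply: andb_idl => /leq_trans; apply.
Qed.

Fixpoint width (p : seq O) : R := if p is o :: q then width q * weight q o else 1.

Fixpoint left_end (p : seq O) : R :=
  if p is o :: q then left_end q + width q * cum q (enum_rank o) else 0.

Definition in_cell p (w : measurableTypeR R) : bool :=
  left_end p <= (w : R) < left_end p + width p.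

Lemma width_ge0 p : 0 <= width p.
Proof. by elim: p => //= o p IH; rewrite mulr_ge0. Qed.

Lemma in_cell_cons o p w : in_cell (o :: p) w =
  (left_end p + width p * cum p (enum_rank o) <= (w : R)
   < left_end p + width p * cum p (enum_rank o).+1).
Proof. by rewrite /in_cell /= cumS mulrDr addrA. Qed.

Lemma in_cell_behead o p w : in_cell (o :: p) w -> in_cell p w.
Proof.
rewrite in_cell_cons => /andP[h1 h2]; have w0 := width_ge0 p; apply/andP; split.
  apply: le_trans h1; rewrite lerDl mulr_ge0 // -(cum0 p); exact: le_cum.
apply: (lt_le_trans h2); rewrite lerD2l ler_piMr // -(cum_card p); exact: le_cum.
Qed.

Lemma in_cell_inj o o' p w : in_cell (o :: p) w -> in_cell (o' :: p) w -> o = o'.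
Proof.
rewrite !in_cell_cons => /andP[a1 a2] /andP[b1 b2].
have lt j k : left_end p + width p * cum p j <= w ->
    w < left_end p + width p * cum p k -> (j < k)%N.
  move=> h1 h2; rewrite ltnNge; apply/negP => /(le_cum p) kj.
  have := le_lt_trans h1 h2; rewrite ltrD2l ltNge => /negP; apply.
  by rewrite ler_wpM2l // width_ge0.
apply: enum_rank_inj; apply/val_inj/anti_leq.
by rewrite -ltnS (lt _ _ a1 b2) -ltnS (lt _ _ b1 a2).
Qed.

Lemma in_cell_cover p w : in_cell p w -> exists o, in_cell (o :: p) w.
Proof.
move=> /andP[h1 h2].
(* The child containing [w] is the one whose right end is the first boundary beyond [w]; boundary 0
   is excluded, being the left end of the cell. *)
pose Q k := w < left_end p + width p * cum p k.
have exQ : exists k, Q k by exists #|O|; rewrite /Q cum_card mulr1.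
case: (ex_minnP exQ) => -[|k] Qk mink.
  by move: Qk; rewrite /Q cum0 mulr0 addr0 ltNge h1.
have kO : (k < #|O|)%N by rewrite mink // /Q cum_card mulr1.
exists (enum_val (Ordinal kO)); rewrite in_cell_cons enum_valK; apply/andP; split=> //.
by rewrite leNgt; apply/negP => /mink; rewrite ltnn.
Qed.

(* The default [o0] only matters off the unit interval, where no cell contains
   [w]. *)
Definition next_outcome p (w : measurableTypeR R) : O := odflt o0 [pick o | in_cell (o :: p) w].

Fixpoint path_at t (w : measurableTypeR R) : seq O :=
  if t is s.+1 then next_outcome (path_at s w) w :: path_at s w else [::].

Lemma size_path t w : size (path_at t w) = t.
Proof. by elim: t => //= t ->. Qed.

Lemma next_outcomeP p o w : in_cell (o :: p) w -> next_outcome p w = o.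
Proof.
move=> h; rewrite /next_outcome; case: pickP => [a h'|none]; last by rewrite none in h.
exact: in_cell_inj h' h.
Qed.

Lemma path_in_cell t w : 0 <= (w : R) < 1 -> in_cell (path_at t w) w.
Proof.
move=> w01; elim: t => [|t IH] /=; first by rewrite /in_cell /= add0r.
by have [a ha] := in_cell_cover IH; rewrite (next_outcomeP ha).
Qed.

Lemma in_cell_path p w : in_cell p w -> path_at (size p) w = p.
Proof.
elim: p => //= o p IH h; rewrite (IH (in_cell_behead h)).
by rewrite (next_outcomeP h).
Qed.

Lemma measurable_in_cell p : measurable [set w | in_cell p w].
Proof.
rewrite (_ : [set w | _] = `[left_end p, left_end p + width p[%classic).
  exact: measurable_itv.
by apply/seteqP; split=> w /=; rewrite in_itv.
Qed.

Lemma measurable_next p o : measurable [set w | next_outcome p w = o].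
Proof.
have ex : measurable [set w | exists o', in_cell (o' :: p) w].
  rewrite (_ : [set w | _] = \bigcup_(o' in [set: O]) [set w | in_cell (o' :: p) w]).
    by apply: fin_bigcup_measurable => // o' _; exact: measurable_in_cell.
  by apply/seteqP; split=> w [a h]; exists a.
(* The default outcome also collects the points that lie in no child of [p]. *)
rewrite (_ : [set w | _] = [set w | in_cell (o :: p) w] `|`
    (if o == o0 then ~` [set w | exists o', in_cell (o' :: p) w] else set0)).
  apply: measurableU; first exact: measurable_in_cell.
  by case: ifP => _; [exact: measurableC|exact: measurable0].
apply/seteqP; split=> w /=.
  rewrite /next_outcome; case: pickP => [a h' /= <-|no /= <-]; first by left.
  by right; rewrite eqxx => -[a h']; rewrite no in h'.
case=> [|]; first exact: next_outcomeP.
case: eqP => // -> no; rewrite /next_outcome; case: pickP => //= a h'.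
by case: no; exists a.
Qed.

(** Tuples of fixed length form a finite type, which gives access to the lemmas on finite fibres. *)
Definition tpath t w : t.-tuple O := Tuple (introT eqP (size_path t w)).

Lemma measurable_path t p : measurable [set w | path_at t w = p].
Proof.
elim: t p => [|t IH] p.
  case: p => [|o p]; last by rewrite (_ : [set w | _] = set0) //; apply/seteqP; split.
  by rewrite (_ : [set w | _] = setT) //; apply/seteqP; split.
case: p => [|o p]; first by rewrite (_ : [set w | _] = set0) //; apply/seteqP; split.
rewrite (_ : [set w | _] =
    [set w | path_at t w = p] `&` [set w | next_outcome p w = o]).
  by apply: measurableI => //; exact: measurable_next.
by apply/seteqP; split=> w /=; [case=> <- <-|case=> -> ->].
Qed.

Lemma measurable_tpath t p : measurable [set w | tpath t w = p].
Proof.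
rewrite (_ : [set w | _] = [set w | path_at t w = p]); first exact: measurable_path.
by apply/seteqP; split=> w /= => [<-|h] //; exact: val_inj.
Qed.

Lemma measurable_path_set t (S : seq O -> Prop) : measurable [set w | S (path_at t w)].
Proof.
apply: (measurable_fin_set (@measurable_tpath t) (Q := fun _ p => S p)) => p.
have [Sp|nSp] := pselect (S p).
  by rewrite (_ : [set _ | _] = setT) //; apply/seteqP; split.
by rewrite (_ : [set _ | _] = set0) //; apply/seteqP; split.
Qed.

(** Within the unit interval, following [p] means lying in its cell, an interval of this length. *)
Lemma path_law p : unit_prob [set w | path_at (size p) w = p] = (width p)%:E.
Proof.
rewrite /unit_prob /mrestr /=.
rewrite (_ : _ `&` _ = `[left_end p, left_end p + width p[%classic).
  rewrite lebesgue_measure_itv /= lte_fin ltrDl; case: ifPn => [_|].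
    by rewrite -EFinB addrAC subrr add0r.
  by rewrite -leNgt => h; congr (_%:E); apply/eqP; rewrite eq_le h width_ge0.
have sub w : in_cell p w -> in_cell [::] w.
  by elim: p => //= o p IH /in_cell_behead.
apply/seteqP; split=> w /=; rewrite !in_itv /=.
  by move=> [<- w01]; exact: path_in_cell.
by move=> h; split; [exact: in_cell_path|have := sub w h; rewrite /in_cell /= add0r].
Qed.

(** In the cell of each path in [S], the children with outcome in [Q] fill the fraction [c]; the
    claim sums this over the finitely many paths of length [t]. *)
Lemma branch_law t (S : seq O -> Prop) (Q : pred O) (c : R) :
  (forall p, S p -> size p = t -> \sum_(o | Q o) weight p o = c) ->
  (unit_prob ([set w | S (path_at t w)] `&` [set w | Q (next_outcome (path_at t w) w)]) =
   c%:E * unit_prob [set w | S (path_at t w)])%E.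
Proof.
move=> Sc.
have mS : measurable [set w | S (path_at t w)] by exact: measurable_path_set.
have mQ : measurable ([set w | S (path_at t w)] `&`
    [set w | Q (next_outcome (path_at t w) w)]).
  have := measurable_path_set t.+1 (fun p => S (behead p) /\ Q (head o0 p)).
  by congr measurable; apply/seteqP; split.
rewrite !(measure_fibres (@measurable_tpath t) (@unit_prob R)) //.
rewrite ge0_sume_distrr //; apply: eq_bigr => p _.
have tpE w : tpath t w = p <-> path_at t w = p by split=> [<-//|h]; exact: val_inj.
set A := [set w | S (path_at t w)]; set B := [set w | Q _].
set C := [set w | tpath t w = p].
have [Sp|nSp] := pselect (S p); last first.
  have AC : A `&` C = set0 by apply/seteqP; split=> w //= [+ /tpE wp]; rewrite /A /= wp.
  by rewrite setIAC AC set0I measure0 mule0.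
have AC : A `&` C = [set w | path_at (size p) w = p].
  apply/seteqP; split=> w; rewrite size_tuple /A /=; first by case=> _ /tpE.
  by move=> wp; rewrite wp; split=> //; exact/tpE.
rewrite setIAC AC.
transitivity (c%:E * (width p)%:E)%E; last by congr (_ * _)%E; exact/esym/path_law.
rewrite (measure_fibres (measurable_next p) (@unit_prob R)); last first.
  by rewrite -AC setIAC; apply: measurableI => //; exact: measurable_tpath.
rewrite -(Sc p Sp (size_tuple p)) -EFinM mulr_suml -sumEFin [RHS]big_mkcond /=.
apply: eq_bigr => o _; case: ifPn => Qo; last first.
  rewrite (_ : _ `&` _ = set0) ?measure0 //; apply/seteqP; split=> w //=.
  rewrite size_tuple /B /= => -[[-> +] E]; rewrite E.
  by move: Qo => /negP.
have := path_law (o :: p); rewrite /= mulrC => <-; congr (unit_prob _).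
apply/seteqP; split=> w; rewrite /B /=.
  by move=> [[wp _] wo]; rewrite wp wo.
by rewrite size_tuple => -[wo wp]; rewrite wp in wo *; rewrite wo.
Qed.

End Tree.

(** * Realizations with finitely valued disturbances and a fixed start *)

Section Construction.
Context {R : realType} {n : nat} {Lat : finType} {Hmax : nat}.
Variables (Sys : ehcs R n Lat Hmax) (u : policy Sys) (W : 'M[R]_n).
Variables (Z : finType) (z0 : Z) (q : Z -> R) (vec : Z -> 'cV[R]_n).
Hypothesis q_ge0 : forall z, 0 <= q z.
Hypothesis q_sum1 : \sum_z q z = 1.
Hypothesis vec_mean : forall i, \sum_z q z * vec z i 0 = 0.
Hypothesis vec_moment : forall i j, \sum_z q z * (vec z i 0 * vec z j 0) = W i j.
Variables (c0 : config Sys) (x0 : 'cV[R]_n).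

Definition outcome := (draw Sys * Z)%type.
Definition outcome0 : outcome := ((ord0, false, c0.1.2), z0).

Fixpoint path_config (p : seq outcome) : config Sys :=
  if p is o :: r then next_config (path_config r) o.1 else c0.

Definition path_weight (p : seq outcome) (o : outcome) : R :=
  step_prob u (path_config p) o.1 * q o.2.

Fixpoint path_plant (p : seq outcome) : 'cV[R]_n :=
  if p is o :: r then plant_mx Sys o.1.1.2 *m path_plant r + vec o.2 else x0.

Local Notation path t w := (path_at outcome0 path_weight t w).
Local Notation out t w := (next_outcome outcome0 path_weight (path t w) w).

Definition run : processes Sys (measurableTypeR R) := Processes
  (fun t w => (path_config (path t w)).1.1)
  (fun t w => (path_config (path t w)).1.2)
  (fun t w => (out t w).1.1.1)
  (fun t w => (out t w).1.1.2)
  (fun t w => (path_config (path t w)).2)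
  (fun t w => vec (out t w).2)
  (fun t w => path_plant (path t w)).

Lemma path_weight_ge0 p o : 0 <= path_weight p o.
Proof. by rewrite mulr_ge0 ?step_prob_ge0. Qed.

Lemma path_weight_event p (D : pred (draw Sys)) (N : pred Z) :
  \sum_(o : outcome | D o.1 && N o.2) path_weight p o =
  (\sum_(o | D o) step_prob u (path_config p) o) * \sum_(z | N z) q z.
Proof.
rewrite mulr_suml; under [RHS]eq_bigr do rewrite mulr_sumr.
by rewrite pair_big /=; apply: eq_bigl => -[].
Qed.

Lemma path_weight_sum1 p : \sum_o path_weight p o = 1.
Proof.
have := path_weight_event p predT predT; rewrite /= => ->.
by rewrite step_prob_sum1 q_sum1 mulr1.
Qed.

Lemma path_prefix k t w w' : (k <= t)%N -> path t w = path t w' -> path k w = path k w'.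
Proof.
elim: t => [|t IH]; first by rewrite leqn0 => /eqP ->.
by rewrite leq_eqVlt ltnS => /orP[/eqP -> //|kt] [_]; exact: IH.
Qed.

Lemma out_prefix k t w w' : (k < t)%N -> path t w = path t w' -> out k w = out k w'.
Proof. by move=> kt /(path_prefix kt)[]. Qed.

(** The sets that do not separate points with equal paths form a sigma-algebra. It contains the
    generators of the past, since the initial state is constant and the path records every outcome
    before [t]. *)
Lemma past_determined t A : past run t A ->
  forall w w', path t w = path t w' -> A w <-> A w'.
Proof.
pose Det := [set A : set (measurableTypeR R) |
  forall w w', path t w = path t w' -> A w <-> A w'].
suff : past run t `<=` Det by apply.
apply: smallest_sub => [|B].
  split.
  - by [].
  - by move=> B DB w w' ww'; have := DB w w' ww'; rewrite /= /setD /=; tauto.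
  - move=> F DF w w' ww'; split=> -[k _ Fk]; exists k => //.
      by apply/(DF k _ _ ww').
    by apply/(DF k _ _ ww').
case=> [i C _|b|f|k l kt|k e kt|k g kt|k i C kt _] w w' ww' //=.
- by rewrite (path_prefix kt ww').
- by rewrite (out_prefix kt ww').
- by rewrite (out_prefix kt ww').
- by rewrite (out_prefix kt ww').
Qed.

Lemma past_path t A : past run t A -> exists S : seq outcome -> Prop,
  A = [set w | S (path t w)].
Proof.
move=> pA; exists (fun p => exists2 w, A w & path t w = p).
apply/seteqP; split=> w /= => [Aw|[w' Aw' ww']]; first by exists w.
exact/(past_determined pA ww').
Qed.

Lemma run_measurable t A : past_event run t A -> measurable A.
Proof.
move=> pA; have [|S ->] := @past_path t A; first exact: sub_sigma_algebra.
exact (measurable_path_set outcome0 path_weight_ge0 t S).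
Qed.

Lemma run_branch t (S : seq outcome -> Prop) c (D : pred (draw Sys)) (N : pred Z) :
  (forall p, S p -> path_config p = c) ->
  (unit_prob ([set w | S (path t w)] `&` [set w | D (out t w).1 && N (out t w).2]) =
   ((\sum_(o | D o) step_prob u c o) * \sum_(z | N z) q z)%:E *
   unit_prob [set w | S (path t w)])%E.
Proof.
move=> Sc; apply: (branch_law outcome0 path_weight_ge0 path_weight_sum1
  (Q := fun o => D o.1 && N o.2)) => p Sp _.
by rewrite path_weight_event (Sc p Sp).
Qed.

Lemma run_noise0 (N : pred Z) :
  unit_prob [set w | N (out 0 w).2] = (\sum_(z | N z) q z)%:E.
Proof.
have H := @run_branch 0 (fun p => p = [::]) c0 predT N (fun p => @congr1 _ _ path_config p [::]).
move: H; rewrite step_prob_sum1 mul1r /=.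
rewrite (_ : [set w | [::] = [::]] = setT); last by apply/seteqP; split.
by rewrite setTI unit_probT mule1.
Qed.

Lemma measurable_noise0 z : measurable [set w | (out 0 w).2 = z].
Proof.
have -> : [set w | (out 0 w).2 = z] = [set w | exists o r, path 1 w = o :: r /\ o.2 = z].
  apply/seteqP; split=> w /= => [E|[a [r [[<- _] ->]]]] //.
  by exists (out 0 w), [::].
exact (measurable_path_set outcome0 path_weight_ge0 1 (fun p => exists o r, p = o :: r /\ o.2 = z)).
Qed.

Lemma expectation_noise0 (g : 'cV[R]_n -> R) :
  ('E_(@unit_prob R)[fun w => g (noise run 0 w)] = (\sum_z q z * g (vec z))%:E)%E.
Proof.
rewrite unlock; rewrite (integral_fin measurable_noise0 _ (fun z => g (vec z))).
rewrite -sumEFin; apply: eq_bigr => z _.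
have := run_noise0 (pred1 z); rewrite big_pred1_eq mulrC EFinM => <-.
congr (_ * unit_prob _)%E.
by apply/seteqP; split=> w /= /eqP.
Qed.

Lemma run_step_law t A : past run t A ->
  forall b l f e g l' (C : 'I_n -> set R), (forall i, measurable (C i)) ->
  let now := A `&` [set w | [/\ bat run t w = b, lat run t w = l & hist run t w = f]] in
  (unit_prob (now `&` [set w | [/\ ener run t w = e, loop run t w = g,
                       in_box (noise run t w) C & lat run t.+1 w = l']])
   = (u b l f e * loop_prob e g * trans Sys l' l)%:E
     * unit_prob [set w | in_box (noise run 0 w) C] * unit_prob now)%E.
Proof.
move=> /past_path[S ->] b l f e g l' C _ /=.
pose N := [pred z | `[< in_box (vec z) C >]].
have -> : [set w | in_box (vec (out 0 w).2) C] = [set w | N (out 0 w).2].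
  by apply/seteqP; split=> w /= /asboolP.
rewrite run_noise0 -EFinM.
(* Fixing the configuration gives all these paths the same one-step weights, as [run_branch]
   requires. *)
pose S' p := S p /\ path_config p = (b, l, f).
have -> : [set w | S (path t w)] `&` [set w | [/\ (path_config (path t w)).1.1 = b,
    (path_config (path t w)).1.2 = l & (path_config (path t w)).2 = f]] =
    [set w | S' (path t w)].
  apply/seteqP; split=> w /=; rewrite /S'; case: (path_config _) => [[b' l''] f'] /=.
    by move=> [? [-> -> ->]].
  by move=> [? [-> -> ->]].
have := @run_branch t S' (b, l, f) (pred1 (e, g, l')) N (fun p => @proj2 _ _).
rewrite big_pred1_eq /step_prob /= => <-; congr (unit_prob _); congr (_ `&` _).
apply/seteqP; split=> w /=.
  case: (out t w) => [[[e' g'] l''] z] /= [-> -> box ->].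
  by rewrite eqxx; exact/asboolP.
case: (out t w) => [[[e' g'] l''] z] /= => /andP[/eqP[-> -> ->] /asboolP box].
by split.
Qed.

Lemma run_realization : realization u W (@unit_prob R) run.
Proof.
split=> //.
- exact: run_measurable.
- exact: run_step_law.
(* The initial latent state is deterministic, hence independent of everything: its events have
   probability 0 or 1. *)
- move=> b l f C _ /=; have [->|nl] := pselect (c0.1.2 = l).
    rewrite (_ : [set w | l = l] = setT); last by apply/seteqP; split.
    by rewrite setIT unit_probT mule1.
  rewrite (_ : [set w | c0.1.2 = l] = set0); last by apply/seteqP; split.
  by rewrite setI0 measure0 mule0.
- by move=> i; rewrite (expectation_noise0 (fun y => y i 0)) vec_mean.
- by move=> i j; rewrite (expectation_noise0 (fun y => y i 0 * y j 0)) vec_moment.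
Qed.

End Construction.

(** * A finitely valued disturbance with prescribed second moments *)

Section SquareRootNoise.
Context {R : realType} {m : nat}.
Variable B : 'M[R]_m.+1.

(** A uniformly random column of [B] with a random sign. The sign centres it, and the square root
    compensates for the probability 1/(m+1) of each column. *)
Definition sqrt_noise (z : 'I_m.+1 * bool) : 'cV[R]_m.+1 :=
  ((-1) ^+ z.2 * Num.sqrt m.+1%:R) *: col z.1 B.

Definition noise_weight (z : 'I_m.+1 * bool) : R := (2 * m.+1%:R)^-1.

Lemma noise_weight_ge0 z : 0 <= noise_weight z.
Proof. by rewrite invr_ge0 mulr_ge0. Qed.

Lemma noise_weight_sum1 : \sum_z noise_weight z = 1.
Proof.
rewrite /noise_weight sumr_const card_prod card_ord card_bool -[LHS]mulr_natl.
by rewrite natrM [_ * 2%:R]mulrC mulfV // mulf_neq0.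
Qed.

Lemma sqrt_noise_mean i : \sum_z noise_weight z * sqrt_noise z i 0 = 0.
Proof.
rewrite -(pair_bigA _ (fun k b => noise_weight (k, b) * sqrt_noise (k, b) i 0)) /=.
apply: big1 => k _; rewrite big_bool /sqrt_noise /noise_weight /= !mxE; ring.
Qed.

Lemma sqrt_noise_moment i j :
  \sum_z noise_weight z * (sqrt_noise z i 0 * sqrt_noise z j 0) = (B *m B^T) i j.
Proof.
rewrite -(pair_bigA _ (fun k b => noise_weight (k, b) *
  (sqrt_noise (k, b) i 0 * sqrt_noise (k, b) j 0))) /= mxE.
apply: eq_bigr => k _; rewrite big_bool /sqrt_noise /noise_weight /= !mxE.
have := @sqr_sqrtr R m.+1%:R (ler0n _ _); set s := Num.sqrt _ => s2.
have m0 : m.+1%:R != 0 :> R by [].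
rewrite expr0 expr1; transitivity ((2 * m.+1%:R)^-1 * (2 * s ^+ 2) * (B i k * B j k)).
  by ring.
by rewrite s2 mulVf ?mul1r // mulf_neq0.
Qed.

End SquareRootNoise.

(** * Stability implies the Lyapunov condition *)

Lemma quadratic_dominance (R : realType) (a b c : R) : 0 <= c ->
  (forall s, s ^+ 2 * a <= s ^+ 2 * b + c) -> a <= b.
Proof.
move=> c0 h; rewrite leNgt; apply/negP => ba.
have ab : 0 < a - b by rewrite subr_gt0.
(* At s = 1 + t one has s^2 (a - b) = (a - b) + 2 c + t c > c. *)
pose t := c / (a - b); have t0 : 0 <= t by rewrite divr_ge0 // ltW.
have tE : t * (a - b) = c by rewrite divfK ?gt_eqF.
have := h (1 + t); nra.
Qed.

Lemma small_power (R : realType) (alpha xi : R) : 0 < xi < 1 ->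
  exists N, alpha * xi ^+ N <= 2^-1.
Proof.
move=> /andP[xi0 xi1].
have xi1' : `|xi| < 1 by rewrite ger0_norm // ltW.
have h2 : (0 : R) < 2^-1 by rewrite invr_gt0.
have [N _ HN] := cvgr_lt _ (cvg_geometric alpha xi1') _ h2.
by exists N; apply/ltW; exact: HN N (leqnn N).
Qed.

Section Necessity.
Context {R : realType} {n : nat} {Lat : finType} {Hmax : nat}.
Variables (Sys : ehcs R n Lat Hmax) (u : policy Sys) (W : 'M[R]_n).

Lemma psd_iter_adjoint t (V : config Sys -> 'M[R]_n) :
  (forall c, psdmx (V c)) -> forall c, psdmx (iter t (adjoint u) V c).
Proof. by move=> pV; elim: t => //= t IH; exact: psd_adjoint. Qed.

Lemma response0_qf d (T : measurableType d) (P : probability T R) (X : processes Sys T)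
  (V : config Sys -> 'M[R]_n) t : realization u W P X -> (forall c, psdmx (V c)) ->
  (\int[P]_w (qf (V (config_at X t w)) (response X 0 t w))%:E =
   \int[P]_w (qf (iter t (adjoint u) V (config_at X 0 w)) (plant X 0 w))%:E)%E.
Proof.
(* The last step of the process corresponds to the innermost adjoint, so [V] varies in the
   induction. *)
move=> RX; elim: t V => [//|t IH] V pV; rewrite iterSr -IH; last exact: psd_adjoint.
have pr := @past_response _ _ _ _ _ _ _ X 0 t.
rewrite -(past_drift RX pr) //.
by apply: eq_integral => w _ /=; rewrite scale0r addr0.
Qed.

Lemma qf_adjoint_sum (V : nat -> config Sys -> 'M[R]_n) N c x :
  qf (adjoint u (fun c => \sum_(t < N) V t c) c) x =
  \sum_(t < N) qf (adjoint u (V t) c) x.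
Proof.
rewrite qf_adjoint; under [RHS]eq_bigr do rewrite qf_adjoint.
rewrite exchange_big /=; apply: eq_bigr => o _.
by rewrite qf_sum mulr_sumr.
Qed.

(** With V the sum of T^t I over t < N, the difference V - T V telescopes to I - T^N I, which is at
    least I / 2. *)
Lemma lyapunov_of_decay N :
  (forall c x, qf (iter N (adjoint u) (fun=> 1%:M) c) x <= 2^-1 * sqnorm2 x) ->
  lyapunov u.
Proof.
set V0 := fun=> _; move=> decay; exists 2^-1, (fun c => \sum_(t < N) iter t (adjoint u) V0 c).
split=> [|c|c x].
- by rewrite invr_gt0.
- by apply: psd_sum => t _; apply: psd_iter_adjoint => c'; exact: psd_scalar.
rewrite (qf_adjoint_sum (fun t => iter t (adjoint u) V0)) qf_sum.
pose Q t := qf (iter t (adjoint u) V0 c) x.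
have tel : \sum_(t < N) Q t.+1 + sqnorm2 x = \sum_(t < N) Q t + Q N.
  transitivity (\sum_(t < N.+1) Q t); last by rewrite big_ord_recr.
  by rewrite big_ord_recl /Q /= qf1 addrC.
rewrite -[X in X <= _]/(\sum_(t < N) Q t.+1) -[X in _ <= X - _]/(\sum_(t < N) Q t).
have : Q N <= 2^-1 * sqnorm2 x := decay c x; lra.
Qed.

(* Runs from opposite initial states share the disturbances, so half of their
   difference is free of disturbances. *)
Lemma run_opp (Z : finType) (z0 : Z) (q : Z -> R) (vec : Z -> 'cV[R]_n) c y t w :
  plant (run u z0 q vec c y) t w - plant (run u z0 q vec c (- y)) t w =
  2 *: response (run u z0 q vec c y) 0 t w.
Proof.
elim: t => [|t IH]; first by rewrite /= opprK scaler_nat mulr2n.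
by rewrite [response _ _ _ _]/= scale0r addr0 scalemxAr -IH mulmxBr /=
   opprD addrACA subrr addr0.
Qed.

(** The stability bound is used for the runs from s x and -s x; as its constants do not depend on s,
    the additive one disappears for large s. *)
Lemma stable_decay (Z : finType) (z0 : Z) (q : Z -> R) (vec : Z -> 'cV[R]_n) :
  (forall z, 0 <= q z) -> \sum_z q z = 1 ->
  (forall i, \sum_z q z * vec z i 0 = 0) ->
  (forall i j, \sum_z q z * (vec z i 0 * vec z j 0) = W i j) ->
  stable u W -> exists N, forall c x,
    qf (iter N (adjoint u) (fun=> 1%:M) c) x <= 2^-1 * sqnorm2 x.
Proof.
move=> q0 q1 mean0 moment [alpha [xi [M [_ xi01 M0 stab]]]].
have [N smallN] := small_power alpha xi01; exists N => c x.
apply: le_trans (ler_wpM2r (sqnorm2_ge0 x) smallN).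
(* The maximum supplies the nonnegative constant that [quadratic_dominance] asks for. *)
pose B := Num.max 0 (M * \tr W).
apply: (@quadratic_dominance _ _ _ B) => [|s]; first by rewrite le_max lexx.
have RX y := run_realization u z0 q0 q1 mean0 moment c y.
pose X y := run u z0 q vec c y; pose P : probability _ R := @unit_prob R.
have E0 y : ('E_P[fun w => sqnorm2 (plant (X y) 0 w)] = (sqnorm2 y)%:E)%E.
  exact: (expectation_cst P (sqnorm2 y)).
have mS y : measurable_fun setT (fun w => sqnorm2 (plant (X y) N w)).
  by apply: measurable_sqnorm2; exact: (measurable_plant (RX y)).
have bound y : (\int[P]_w (sqnorm2 (plant (X y) N w))%:E <=
    (alpha * xi ^+ N * sqnorm2 y + B)%:E)%E.
  have := stab _ _ P (X y) (RX y); rewrite E0 ltry => /(_ isT N).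
  rewrite -EFinM -EFinD unlock => /le_trans; apply.
  by rewrite lee_fin lerD2l le_max lexx orbT.
set y := s *: x.
have -> : s ^+ 2 * qf (iter N (adjoint u) (fun=> 1%:M) c) x =
    qf (iter N (adjoint u) (fun=> 1%:M) c) y by rewrite qfZv.
have -> : s ^+ 2 * (alpha * xi ^+ N * sqnorm2 x) = alpha * xi ^+ N * sqnorm2 y.
  by rewrite -(qf1 y) qfZv qf1; ring.
have pI (c' : config Sys) : psdmx (1%:M : 'M[R]_n) by exact: psd_scalar.
have qfE : (\int[P]_w (sqnorm2 (response (X y) 0 N w))%:E =
    (qf (iter N (adjoint u) (fun=> 1%:M) c) y)%:E)%E.
  under eq_integral do rewrite -qf1.
  rewrite (response0_qf (V := fun=> 1%:M) N (RX y) pI).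
  have := expectation_cst P (qf (iter N (adjoint u) (fun=> 1%:M) c) y).
  rewrite unlock => <-; apply: eq_integral => w _.
  by have -> : config_at (X y) 0 w = c by rewrite /config_at /= -!surjective_pairing.
rewrite -lee_fin -qfE.
(* The response is half the difference of the two plants, and Young's inequality with parameter 1
   gives |a/2 - b/2|^2 <= |a|^2/2 + |b|^2/2. *)
have half w : sqnorm2 (response (X y) 0 N w) <=
    2^-1 * sqnorm2 (plant (X y) N w) + 2^-1 * sqnorm2 (plant (X (- y)) N w).
  have : response (X y) 0 N w = 2^-1 *: plant (X y) N w + (- 2^-1) *: plant (X (- y)) N w.
    by rewrite scaleNr -scalerBr run_opp scalerA mulVf // scale1r.
  move=> ->; rewrite -!qf1.
  have := qf_young (2^-1 *: plant (X y) N w) ((- 2^-1) *: plant (X (- y)) N w)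
    (pI c) ltr01.
  by rewrite !qfZv invr1; congr (_ <= _); field.
have h2 : (0 : R) <= 2^-1 by rewrite invr_ge0.
apply: (@le_trans _ _ (\int[P]_w (2^-1 * sqnorm2 (plant (X y) N w) +
    2^-1 * sqnorm2 (plant (X (- y)) N w))%:E)%E).
  apply: le_integral_real => //.
  - by apply: measurable_sqnorm2; exact: measurable_response (RX y) 0 N.
  - by apply: measurable_funD; exact: measurable_funM.
  - by move=> w; exact: sqnorm2_ge0.
have S0 z w : 0 <= sqnorm2 (plant (X z) N w) by exact: sqnorm2_ge0.
rewrite (integral_lin P (mS y) (mS (- y)) (S0 y) (S0 (- y)) h2 h2).
apply: le_trans (leeD (lee_wpmul2l _ (bound y)) (lee_wpmul2l _ (bound (- y)))) _.
- by rewrite lee_fin.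
- by rewrite lee_fin.
rewrite -!EFinM -EFinD lee_fin -(qf1 (- y)) qfNv qf1; lra.
Qed.

End Necessity.

Lemma stable_lyapunov (R : realType) (n : nat) (Lat : finType) (Hmax : nat)
    (Sys : ehcs R n Lat Hmax) (u : policy Sys) (W : 'M[R]_n) : pdmx W -> stable u W -> lyapunov u.
Proof.
(* The disturbance picks a random column, so dimension 0 is treated apart; there every quadratic
   form vanishes. *)
move=> Wpd st; case: n Sys u W Wpd st => [|m] S v U Upd st.
  exists 1, (fun=> 0); split=> // [c|c x]; first exact: psd0.
  by rewrite !qfE !big_ord0 /sqnorm2 big_ord0 mulr0 subrr.
have [B UB] := pd_cholesky Upd.
have moment i j : \sum_z noise_weight z * (sqrt_noise B z i 0 * sqrt_noise B z j 0) =
    U i j by rewrite UB sqrt_noise_moment.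
have [N dec] := stable_decay (ord0, false) (@noise_weight_ge0 R m)
  (@noise_weight_sum1 R m) (sqrt_noise_mean B)
  moment st.
exact: lyapunov_of_decay dec.
Qed.

Theorem theorem1 (R : realType) (n : nat) (Lat : finType) (Hmax : nat)
    (Sys : ehcs R n Lat Hmax) (u : policy Sys)
    (W : 'M[R]_n) (W_pd : pdmx W) (D : R) (D_gt0 : 0 < D) :
  stable u W <-> sdp_value u D = (- D)%:E.
Proof.
rewrite sdp_value_lyapunov //; split; first exact: stable_lyapunov.
exact: lyapunov_stable.
Qed.
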